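(* Let $a_n,b_n,c_n,d_n,e_n,f_n,g_n,h_n,k_n,v_n$ denote the numbers of vertices of type $A,B,C,D,E,F,G,H,K,1$, respectively, on level $n$ of the hyperbolic Pascal simplex based on the hypercube mosaic $\{4,3,3,5\}$. Then for all $n\ge 1$ $$\begin{aligned} a_{n+1}&=\tfrac12\left(2a_n+2b_n+3v_n\right),\\ b_{n+1}&=a_n+2b_n,\\ c_{n+1}&=\tfrac13\left(2a_n+3c_n+2d_n\right),\\ d_{n+1}&=\tfrac12\left(2b_n+3c_n+4d_n+5e_n\right),\\ e_{n+1}&=3c_n+4d_n+6e_n,\\ f_{n+1}&=\tfrac14\left(c_n+4f_n+2g_n\right),\\ g_{n+1}&=\tfrac13\left(d_n+6f_n+6g_n+5h_n\right),\\ h_{n+1}&=\tfrac12\left(e_n+12f_n+12g_n+12h_n+12k_n\right),\\ k_{n+1}&=94f_n+97g_n+101h_n+107k_n,\\ v_{n+1}&=v_n, \end{aligned}$$ with initial values $v_1=4$ and $a_1=b_1=c_1=d_1=e_1=f_1=g_1=h_1=k_1=0$.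
   Context: The mosaic $\{4,3,3,5\}$ is the regular tessellation of hyperbolic 4-space by 4-dimensional hypercubes $\{4,3,3\}$ with vertex figure the 600-cell $\{3,3,5\}$ (so 600 hypercubes and 120 edges meet at each vertex). Hyperbolic Pascal simplex. Fix a vertex $V_0$ of the mosaic. The value (sign) of a vertex is the number of shortest paths along mosaic edges from $V_0$ to that vertex (the value of $V_0$ is $1$). Define a convex part $\mathcal P$ of the mosaic as follows. Take one hypercube containing $V_0$ and let $V_1$ be its vertex opposite to $V_0$ (the vertex of this hypercube with the largest value, namely $24$). Next take all new hypercubes of the mosaic containing $V_1$, and in each of them the vertex with the largest value. Then take all hypercubes containing these vertices, and in each new one the vertex with the largest value, and so on without end. $\mathcal P$ is the set of all hypercubes obtained. The vertices and edges of $\mathcal P$, with each edge directed from its endpoint nearer to $V_0$ to its endpoint farther from $V_0$, form an infinite digraph called the hyperbolic Pascal simplex. Level $n$ is the set of its vertices whose edge-distance from $V_0$ along edges of $\mathcal P$ is $n$. An incoming edge of a vertex on level $n$ is an edge from a vertex on level $n-1$. Vertex types. The boundary of $\mathcal P$ has the combinatorial shape of an infinite simplicial cone with apex $V_0$: four boundary rays, six 2-dimensional faces and four 3-dimensional faces. - Type $1$: vertices on the boundary rays (value $1$). They have degree $5$ in $\mathcal P$, except $V_0$, which has degree $4$. - Types $A$, $B$: vertices in the interior of a 2-dimensional face (degree $7$ in $\mathcal P$), with exactly two (type $A$) or one (type $B$) incoming edges. - Types $C$, $D$, $E$: vertices in the interior of a 3-dimensional face (degree $13$ in $\mathcal P$),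 with exactly three (type $C$), two (type $D$) or one (type $E$) incoming edges. - Types $F$, $G$, $H$, $K$: vertices in the interior of $\mathcal P$ (degree $120$), with exactly four (type $F$), three (type $G$), two (type $H$) or one (type $K$) incoming edges.
   Formalization: The iterative description of P alone gives at most 40 hypercubes (33 edges) at an interior vertex with one incoming edge, not degree 120; so P is also closed under convexity: if two hypercubes of P meet exactly in a square, all five hypercubes around that square belong to P. *)

(* Defs.v *)
From HB Require Import structures.
From mathcomp Require Import all_boot all_order all_algebra.
From mathcomp Require Import finmap.
From mathcomp Require Import all_classical reals.

Set Implicit Arguments.
Unset Strict Implicit.
Unset Printing Implicit Defensive.

Import Order.TTheory GRing.Theory Num.Theory.
Local Open Scope classical_set_scope.
Local Open Scope ring_scope.

(** * The mosaic {4,3,3,5}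

    Hyperbolic 4-space is modelled on the sheet
    [form x x = 2 - sqrt 5], [0 < x_0], of a hyperboloid in R^5.  The time
    coordinate x_0 is rescaled so that one hypercube of the mosaic has the 16
    vertices (1, +-1, +-1, +-1, +-1), its facets lying in the hyperplanes
    x_i = x_0 and x_i = - x_0.  Two adjacent facets of it meet at the angle
    2 pi / 5 exactly when the coefficient of - x_0 ^ 2 is sqrt 5 + 2.  *)

Definition form (R : realType) (x y : 'rV[R]_5) : R :=
  \sum_(i < 5 | i != 0) x 0 i * y 0 i
  - (Num.sqrt 5 + 2) * (x 0 0 * y 0 0).

Definition reflection (R : realType) (a x : 'rV[R]_5) : 'rV[R]_5 :=
  x - (2 * form a x / form a a) *: a.

Definition vec5 (R : realType) (s : seq R) : 'rV[R]_5 := \row_(j < 5) s`_j.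

(** Normals to the walls of the characteristic simplex
    0 <= x_1 <= x_2 <= x_3 <= x_4 <= x_0 of the hypercube.  Once normalised,
    consecutive normals have products - cos (pi / 4), - cos (pi / 3),
    - cos (pi / 3), - cos (pi / 5) and the other pairs are orthogonal: the
    reflections generate the Coxeter group [4,3,3,5].  *)
Definition simple_roots (R : realType) : seq 'rV[R]_5 :=
  [:: vec5 [:: 0; 1; 0; 0; 0];
      vec5 [:: 0; -1; 1; 0; 0];
      vec5 [:: 0; 0; -1; 1; 0];
      vec5 [:: 0; 0; 0; -1; 1];
      vec5 [:: 2 - Num.sqrt 5; 0; 0; 0; -1]].

Definition mosaic_symmetry (R : realType) (g : 'rV[R]_5 -> 'rV[R]_5) : Prop :=
  exists2 w : seq 'rV[R]_5, {subset w <= simple_roots R}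
    & g = fun x => foldr (@reflection R) x w.

(** Cells are represented by their vertex sets.  [base_cell k] is the
    k-dimensional face of the hypercube above on which x_i = 1 for k < i; as
    the mosaic is regular, its k-dimensional cells are the images of this one.
    Vertices, edges, squares, cubes and hypercubes are k = 0, 1, 2, 3, 4.  *)
Definition base_cell (R : realType) (k : nat) : set 'rV[R]_5 :=
  [set x | forall i : 'I_5, x 0 i = 1 \/ ((0 < i <= k)%N /\ x 0 i = -1)].

Definition mosaic_cell (R : realType) (k : nat) (c : set 'rV[R]_5) : Prop :=
  exists2 g, mosaic_symmetry g & c = g @` @base_cell R k.

Definition mosaic_edge (R : realType) : rel 'rV[R]_5 :=
  fun x y => `[< x <> y /\ mosaic_cell 1 [set x; y] >].

(** * Shortest paths and values *)

(** A path from [x] is given by the sequence of its vertices other than [x]. *)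
Definition walk (T : eqType) (e : rel T) (x y : T) (p : seq T) : bool :=
  path e x p && (last x p == y).

Definition shortest_paths (T : eqType) (e : rel T) (x y : T) : set (seq T) :=
  [set p | walk e x y p /\ forall q, walk e x y q -> (size p <= size q)%N].

(** [card A] is the number of elements of [A], provided [A] is finite. *)
Definition card (T : choiceType) (A : set T) : nat := #|` fset_set A|%fset.

Definition value (R : realType) (V0 x : 'rV[R]_5) : nat :=
  card (shortest_paths (@mosaic_edge R) V0 x).

(** * The convex part P and its graph *)

Definition largest_value_vertex (R : realType) (V0 : 'rV[R]_5)
    (Q : set 'rV[R]_5) (x : 'rV[R]_5) : Prop :=
  Q x /\ forall y, Q y -> (value V0 y <= value V0 x)%N.

(** The hypercubes of P.  In [pascal_next], [Q'] need not be new: the vertices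
    of largest value of the old hypercubes have already been treated, so that
    going through them again adds nothing.

    [pascal_convex] is the convexity of P.  Five hypercubes of the mosaic,
    with dihedral angles 2 pi / 5, surround each square.  Two hypercubes that
    share just a square are not neighbours among these five, and a convex set
    containing both contains all five: an angle of 3 * 2 pi / 5 exceeds pi.
    [pascal_next] alone leaves gaps in P.  For instance, at a vertex with one
    incoming edge in the interior of P it reaches only 40 of the 600
    hypercubes, hence only 33 of the 120 edges; the gaps are filled by
    [pascal_convex].  The dihedral angles of the resulting P are 2 pi / 5 and
    4 pi / 5, so that P is convex, and it is the smallest convex set of
    hypercubes closed under [pascal_next].  *)
Inductive pascal (R : realType) (V0 : 'rV[R]_5) (Q0 : set 'rV[R]_5) :
    set 'rV[R]_5 -> Prop :=
| pascal_first : pascal V0 Q0 Q0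
| pascal_next Q x Q' :
    pascal V0 Q0 Q -> largest_value_vertex V0 Q x ->
    mosaic_cell 4 Q' -> Q' x -> pascal V0 Q0 Q'
| pascal_convex Q1 Q2 Q :
    pascal V0 Q0 Q1 -> pascal V0 Q0 Q2 -> mosaic_cell 2 (Q1 `&` Q2) ->
    mosaic_cell 4 Q -> Q1 `&` Q2 `<=` Q -> pascal V0 Q0 Q.

Definition pascal_edge (R : realType) (V0 : 'rV[R]_5) (Q0 : set 'rV[R]_5) :
    rel 'rV[R]_5 :=
  fun x y => `[< mosaic_edge x y /\
                 exists2 Q, pascal V0 Q0 Q & [set x; y] `<=` Q >].

Definition level (R : realType) (V0 : 'rV[R]_5) (Q0 : set 'rV[R]_5) (n : nat) :
    set 'rV[R]_5 :=
  [set x | exists2 p, shortest_paths (pascal_edge V0 Q0) V0 x p & size p = n].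

Definition degree (R : realType) (V0 : 'rV[R]_5) (Q0 : set 'rV[R]_5)
    (x : 'rV[R]_5) : nat :=
  card [set y | pascal_edge V0 Q0 x y].

Definition incoming (R : realType) (V0 : 'rV[R]_5) (Q0 : set 'rV[R]_5)
    (x : 'rV[R]_5) : nat :=
  card [set y | pascal_edge V0 Q0 y x /\
                exists n, level V0 Q0 n y /\ level V0 Q0 n.+1 x].

(** * Vertex types *)

(** The boundary of P consists of the cubes that lie in just one hypercube of
    P.  Likewise, the 2-dimensional faces of P consist of the squares that lie
    in just one hypercube of P (elsewhere on the boundary a square lies in
    two), and the boundary rays consist of the edges that lie in just one.
    [on_face V0 Q0 k x] says that [x] is on a k-dimensional face of P; the
    faces of dimension k - 1 are the boundaries of those of dimension k.  *)
Definition on_face (R : realType) (V0 : 'rV[R]_5) (Q0 : set 'rV[R]_5)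
    (k : nat) (x : 'rV[R]_5) : Prop :=
  exists c, [/\ mosaic_cell k c, c x
              & exists! Q, pascal V0 Q0 Q /\ c `<=` Q].

Inductive vertex_type := tOne | tA | tB | tC | tD | tE | tF | tG | tH | tK.

Definition ray_vertex (R : realType) (V0 : 'rV[R]_5) (Q0 : set 'rV[R]_5)
    (x : 'rV[R]_5) : Prop :=
  [/\ on_face V0 Q0 1 x, value V0 x = 1%N
    & degree V0 Q0 x = if x == V0 then 4%N else 5%N].

Definition face2_vertex (R : realType) (V0 : 'rV[R]_5) (Q0 : set 'rV[R]_5)
    (x : 'rV[R]_5) : Prop :=
  [/\ on_face V0 Q0 2 x, ~ on_face V0 Q0 1 x & degree V0 Q0 x = 7%N].

Definition face3_vertex (R : realType) (V0 : 'rV[R]_5) (Q0 : set 'rV[R]_5)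
    (x : 'rV[R]_5) : Prop :=
  [/\ on_face V0 Q0 3 x, ~ on_face V0 Q0 2 x & degree V0 Q0 x = 13%N].

Definition interior_vertex (R : realType) (V0 : 'rV[R]_5)
    (Q0 : set 'rV[R]_5) (x : 'rV[R]_5) : Prop :=
  ~ on_face V0 Q0 3 x /\ degree V0 Q0 x = 120%N.

Definition has_type (R : realType) (V0 : 'rV[R]_5) (Q0 : set 'rV[R]_5)
    (t : vertex_type) (x : 'rV[R]_5) : Prop :=
  match t with
  | tOne => ray_vertex V0 Q0 x
  | tA => face2_vertex V0 Q0 x /\ incoming V0 Q0 x = 2%N
  | tB => face2_vertex V0 Q0 x /\ incoming V0 Q0 x = 1%N
  | tC => face3_vertex V0 Q0 x /\ incoming V0 Q0 x = 3%N
  | tD => face3_vertex V0 Q0 x /\ incoming V0 Q0 x = 2%N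
  | tE => face3_vertex V0 Q0 x /\ incoming V0 Q0 x = 1%N
  | tF => interior_vertex V0 Q0 x /\ incoming V0 Q0 x = 4%N
  | tG => interior_vertex V0 Q0 x /\ incoming V0 Q0 x = 3%N
  | tH => interior_vertex V0 Q0 x /\ incoming V0 Q0 x = 2%N
  | tK => interior_vertex V0 Q0 x /\ incoming V0 Q0 x = 1%N
  end.

Definition vertex_count (R : realType) (V0 : 'rV[R]_5) (Q0 : set 'rV[R]_5)
    (t : vertex_type) (n : nat) : nat :=
  card [set x | level V0 Q0 n x /\ has_type V0 Q0 t x].

(* Main.v *)
(* The mosaic graph is the Cayley graph of the right-angled Coxeter group
   generated by the reflections in the 120 hyperplanes that bisect the edges at
   a vertex; two generators commute exactly when they are adjacent in the
   600-cell.  Neighbouring walls at a vertex are orthogonal or disjoint, hence a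
   vertex x s, one step above x in direction s, has as incoming directions s
   and those of x that are adjacent to s.  The incoming directions at a vertex
   form a clique of the 600-cell, and each k-cell at x is spanned by a k-clique.

   Let T be the tetrahedron of directions that spans the first hypercube.  The
   local shape of P at x is recorded by the set S of those elements of T that
   are not used on the ascending paths to x: the hypercubes of P at x are those
   spanned by the tetrahedra that contain S, so x lies on a k-dimensional face
   exactly when #|S| >= 4 - k.  An ascending step in P goes either in a
   direction of S, which is then removed from S, or in a direction adjacent to
   all of S.  By the flag transitivity of the 600-cell the number of steps from
   a vertex of one type into the vertices of another type depends only on the
   types, and counting the edges between two levels gives the recurrence. *)
From mathcomp Require Import all_boot all_order all_algebra.

Set Implicit Arguments.
Unset Strict Implicit.
Unset Printing Implicit Defensive.

Import Order.TTheory GRing.Theory Num.Theory.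

(** * The 600-cell *)

(** The rules for P speak of values, largest vertices and convexity; the difficulty is to find the
    exact set of hypercubes that they produce. Two inclusions settle it. [pascal_reached] shows that
    no rule leaves the region described by the states. [reached_pascal] shows, by induction on the
    level, that the rules fill this region: the hypercubes known at a lower neighbour give some of
    those at x, and both rules together spread them over the rest. Values enter only through the
    vertex of largest value, which is a combinatorial top because values add up over incoming edges.

    Facts about the 600-cell are computed on one standard flag, with exact coordinates in Z[golden],
    and transported by symmetries. The factors 1/2, 1/3 and 1/4 of the recurrence arise because each
    edge between two levels is counted at its upper end, where a vertex may have 2, 3 or 4 of
    them. *)

Local Open Scope ring_scope.

(* The pair (a, b) stands for a + b * golden, golden = (1 + sqrt 5) / 2. *)
Definition gadd (x y : int * int) : int * int := (x.1 + y.1, x.2 + y.2).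
Definition gsub (x y : int * int) : int * int := (x.1 - y.1, x.2 - y.2).
Definition gmul (x y : int * int) : int * int :=
  (x.1 * y.1 + x.2 * y.2, x.1 * y.2 + x.2 * y.1 + x.2 * y.2).

(* The form on coordinate lists; (1, 2) is sqrt 5 + 2. *)
Definition gdot (x y : seq (int * int)) : int * int :=
  let c := nth (0, 0) in
  gsub (foldr gadd (0, 0) [seq gmul (c x i) (c y i) | i <- iota 1 4])
       (gmul (1, 2) (gmul (c x 0%N) (c y 0%N))).

(* The reflection in the k-th simple root, 1 <= k <= 4, which fixes the corner
   (1, 1, 1, 1, 1) of the base hypercube. *)
Definition grefl (k : nat) (x : seq (int * int)) : seq (int * int) :=
  let c := nth (0, 0) x in
  match k with
  | 1 => [:: c 0; c 2; c 1; c 3; c 4]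
  | 2 => [:: c 0; c 1; c 3; c 2; c 4]
  | 3 => [:: c 0; c 1; c 2; c 4; c 3]
  | _ => let d := gsub (c 0) (c 4) in
    [:: gadd (c 0) (gmul (-1, 1)%R d); c 1; c 2; c 3;
        gadd (c 4) (gmul (1, 1)%R d)]
  end%N.

Definition gunit (i : nat) : seq (int * int) :=
  [seq ((i == j)%:R, 0) | j <- iota 0 5].

(** Breadth-first search: round i appends the unseen images of the i-th entry, so n rounds exhaust
    an orbit of at most n points. [x0] is read when the list has no i-th entry. *)
Definition orbit_seq (T : eqType) (x0 : T) (f : nat -> T -> T)
    (ks : seq nat) (n : nat) (s : seq T) : seq T :=
  foldl (fun s i =>
    s ++ [seq y <- undup [seq f k (nth x0 s i) | k <- ks] | y \notin s])
    s (iota 0 n).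

(* The unit normals of the hyperplanes that bisect the 120 edges at the corner;
   the first four belong to the edges of the base hypercube.  Orthogonality of
   the normals is adjacency in the 600-cell. *)
Definition groots : seq (seq (int * int)) :=
  Eval vm_compute in
  orbit_seq [::] grefl (iota 1 4) 120 [seq gunit i | i <- iota 1 4].

Definition gperms : seq (seq nat) :=
  Eval vm_compute in
  [seq [seq index (grefl k x) groots | x <- groots] | k <- iota 0 5].

Definition gnbrs : seq (seq nat) :=
  Eval vm_compute in
  [seq [seq j <- iota 0 120 | gdot x (nth [::] groots j) == (0, 0)]
  | x <- groots].

Definition groot (i : nat) := nth [::] groots i.
Definition gperm (k i : nat) := nth 0%N (nth [::] gperms k) i.
Definition gadj (i j : nat) := j \in nth [::] gnbrs i.

Local Open Scope nat_scope.

Lemma groot_gperm k i : k \in iota 1 4 -> i < 120 ->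
  grefl k (groot i) = groot (gperm k i) /\ gperm k i < 120.
Proof.
move=> kP iP.
suff /allP/(_ _ kP)/allP/(_ i) : all (fun k => all (fun i =>
  (grefl k (groot i) == groot (gperm k i)) && (gperm k i < 120)) (iota 0 120))
  (iota 1 4).
  by rewrite mem_iota => /(_ iP)/andP[/eqP].
by vm_compute.
Qed.

(** For an integer, [g.2 < 0] means at most -1; with [g.1 <= 0] the product of two far normals is
    then at most [- golden], hence at most -1, as [rt_far] needs. *)
Lemma groot_gram i j : i < 120 -> j < 120 ->
  let g := gdot (groot i) (groot j) in
  [/\ (i == j) ==> (g == (1, 0)%R), gadj i j ==> (i != j) && (g == (0, 0)%R)
    & [|| i == j, gadj i j | (g.1 <= 0)%R && (g.2 < 0)%R]].
Proof.
move=> iP jP /=.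
suff /allP/(_ i) : all (fun i => all (fun j =>
  let g := gdot (groot i) (groot j) in
  if i == j then (g == (1, 0)%R) && ~~ gadj i j else
  if gadj i j then g == (0, 0)%R else (g.1 <= 0)%R && (g.2 < 0)%R)
  (iota 0 120)) (iota 0 120).
  rewrite mem_iota => /(_ iP)/allP/(_ j); rewrite mem_iota => /(_ jP).
  lazy zeta; case: eqP => [-> /andP[-> /negPf->] //|_].
  by case: gadj => [->|/andP[-> ->]]; rewrite ?implybT.
by vm_compute.
Qed.

Notation gen := 'I_120.

Definition adj : rel gen := fun i j => gadj i j.
Definition gact (k : nat) (i : gen) : gen := inord (gperm k i).
Definition wact (u : seq nat) (i : gen) : gen := foldr gact i u.

Lemma all_gen (P : pred nat) : all P (iota 0 120) -> forall i : gen, P i.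
Proof. by move=> /allP h i; apply: h; rewrite mem_iota ltn_ord. Qed.

Lemma count_gen (P : pred nat) : #|[set i : gen | P i]| = count P (iota 0 120).
Proof.
rewrite -sum1_card (eq_bigl (fun i : gen => P i)); last by move=> i;
  rewrite inE.
by rewrite -sum1_count -(big_mkord P (fun=> 1)) /index_iota subn0.
Qed.

Lemma adj_sym : symmetric adj.
Proof.
move=> i j.
have h (x y : gen) : adj x y -> adj y x.
  move=> a; have : all (fun i => all (fun j => gadj j i) (nth [::] gnbrs i))
                       (iota 0 120) by vm_compute.
  by move/all_gen/(_ x)/allP; apply.
by apply/idP/idP; apply: h.
Qed.

Lemma adj_irr : irreflexive adj.
Proof.
move=> i; apply/negbTE.
have /all_gen : all (fun i => ~~ gadj i i) (iota 0 120) by vm_compute.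
exact.
Qed.

Lemma val_gact k i : k \in iota 1 4 -> gact k i = gperm k i :> nat.
Proof. by move=> /groot_gperm/(_ (ltn_ord i))[_ h]; rewrite inordK. Qed.

Lemma gactK k : k \in iota 1 4 -> involutive (gact k).
Proof.
move=> kP i; apply: val_inj; rewrite /= !val_gact //.
have /allP/(_ k kP)/all_gen/(_ i)/eqP// : all (fun k => all (fun i =>
  gperm k (gperm k i) == i) (iota 0 120)) (iota 1 4) by vm_compute.
Qed.

Lemma adj_gact k i j : k \in iota 1 4 -> adj (gact k i) (gact k j) = adj i j.
Proof.
move=> kP.
have h x y : adj x y -> adj (gact k x) (gact k y).
  rewrite /adj !val_gact // => a.
  have /allP/(_ k kP)/all_gen/(_ x)/allP/(_ _ a)// : all (fun k => all (fun i =>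
    all (fun j => gadj (gperm k i) (gperm k j)) (nth [::] gnbrs i)) (iota 0
      120))
    (iota 1 4) by vm_compute.
by apply/idP/idP => [/h|/h//]; rewrite !gactK.
Qed.

Section Words.

Variable u : seq nat.
Hypothesis uP : {subset u <= iota 1 4}.

Lemma wactK : cancel (wact u) (wact (rev u)).
Proof.
elim: u uP => //= k v IH vP i; rewrite rev_cons /wact foldr_rcons gactK.
  by apply: IH => x xv; apply: vP; rewrite inE xv orbT.
by apply: vP; rewrite inE eqxx.
Qed.

Lemma adj_wact i j : adj (wact u i) (wact u j) = adj i j.
Proof.
elim: u uP i j => //= k v IH vP i j; rewrite adj_gact.
  by apply: IH => x xv; apply: vP; rewrite inE xv orbT.
by apply: vP; rewrite inE eqxx.
Qed.

Lemma wact_inj : injective (wact u).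
Proof. exact: can_inj wactK. Qed.

End Words.

Lemma wactKV u : {subset u <= iota 1 4} -> cancel (wact (rev u)) (wact u).
Proof.
move=> uP; rewrite -{2}(revK u); apply: wactK => x.
by rewrite mem_rev; apply: uP.
Qed.

Lemma orbit_seqP (T : eqType) (x0 : T) f ks n (s : seq T) (Q : T -> Prop) :
  (forall k x, k \in ks -> Q x -> Q (f k x)) -> Q x0 ->
  (forall x, x \in s -> Q x) -> forall x, x \in orbit_seq x0 f ks n s -> Q x.
Proof.
move=> fQ x0Q; rewrite /orbit_seq; elim: (iota 0 n) s => //= i t IH s sQ.
apply: IH => x; rewrite mem_cat => /orP[/sQ//|].
rewrite mem_filter => /andP[_]; rewrite mem_undup => /mapP[k kP ->].
apply: fQ => //; case: (ltnP i (size s)) => [h|h]; last by rewrite nth_default.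
exact/sQ/mem_nth.
Qed.

(* In the Coxeter group [3,3,5] the generators k = m+1 .. 4 fix the first m
   vertices of a flag of the 600-cell and permute the possible next ones. *)
Lemma wact_next m (b : gen) : m < 4 -> (forall i : gen, i < m -> adj i b) ->
  exists2 u, {subset u <= iota m.+1 (4 - m)} & b = wact u (inord m).
Proof.
move=> m4 mb.
(* The bounds 120, 12, 5, 2 are the sizes of the link of an m-clique: the 600-cell, an icosahedron,
   a pentagon, two points. *)
have : val b \in orbit_seq m gperm (iota m.+1 (4 - m))
         (nth 0 [:: 120; 12; 5; 2] m) [:: m].
  have /allP/(_ m)/(_ _)/all_gen/(_ b) : all (fun m => all (fun b =>
    all (gadj^~ b) (iota 0 m) ==> (b \in orbit_seq m gperm (iota m.+1 (4 - m))
         (nth 0 [:: 120; 12; 5; 2] m) [:: m])) (iota 0 120)) (iota 0 4).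
    by vm_compute.
  rewrite mem_iota => /(_ m4)/implyP; apply; apply/allP => i.
  rewrite mem_iota add0n => /= im.
  have i120 : i < 120 by apply: (ltn_trans im); apply: leq_trans m4 _.
  exact: (mb (Ordinal i120)).
have mg : m < 120 by apply: leq_trans m4 _.
pose Q (x : nat) := exists2 u, {subset u <= iota m.+1 (4 - m)} &
  x = wact u (inord m) :> nat.
suff h x : x \in orbit_seq m gperm (iota m.+1 (4 - m))
         (nth 0 [:: 120; 12; 5; 2] m) [:: m] -> Q x.
  by move/h => [u uP ux]; exists u => //; apply: val_inj.
apply: (@orbit_seqP _ _ _ _ _ _ Q) => [k y kP [u uP ->]||y].
- have k4 : k \in iota 1 4.
    move: kP; rewrite !mem_iota => /andP[/(leq_trans _)->//= /leq_trans->//].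
    by rewrite addSn subnKC // ltnW.
  exists (k :: u) => [z|]; last by rewrite -val_gact.
  by rewrite inE => /orP[/eqP->|/uP].
- by exists [::] => //=; rewrite inordK.
by rewrite inE => /eqP->; exists [::] => //=; rewrite inordK.
Qed.

Lemma wact_fix m u (i : gen) : m < 4 -> {subset u <= iota m.+1 (4 - m)} ->
  i < m -> wact u i = i.
Proof.
move=> m4 uP im; elim: u uP => //= k u IH uP.
rewrite IH => [|z zu]; last by apply: uP; rewrite inE zu orbT.
have /uP kP : k \in k :: u by rewrite inE eqxx.
have k4 : k \in iota 1 4.
  move: kP; rewrite !mem_iota => /andP[/(leq_trans _)->//= /leq_trans->//].
  by rewrite addSn subnKC // ltnW.
apply: val_inj; rewrite -[RHS]/(val i) [LHS]val_gact //.
have /allP/(_ m) : all (fun m => all (fun k => all (fun i => gperm k i == i)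
   (iota 0 m)) (iota m.+1 (4 - m))) (iota 0 4) by vm_compute.
rewrite mem_iota => /(_ m4)/allP/(_ _ kP)/allP/(_ i).
by rewrite mem_iota => /(_ im)/eqP.
Qed.

Lemma no_clique5 (b : gen) : ~ (forall i : gen, i < 4 -> adj i b).
Proof.
move=> h.
have /all_gen/(_ b)/negP : all (fun b => ~~ all (gadj^~ b) (iota 0 4))
  (iota 0 120) by vm_compute.
apply; apply/allP => i; rewrite mem_iota add0n => /= i4.
have i120 : i < 120 by apply: leq_trans i4 _.
exact: (h (Ordinal i120)).
Qed.

(** The word for all but the last vertex pulls this one back to a common neighbour of 0, ..., m-1,
    which [wact_next] writes as an image of m under generators fixing those. A fifth vertex would
    contradict [no_clique5]. *)
Lemma flag_transitive (s : seq gen) : pairwise adj s ->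
  size s <= 4 /\
  exists2 u, {subset u <= iota 1 4} &
    s = [seq wact u (inord i) | i <- iota 0 (size s)].
Proof.
elim/last_ind: s => [_|s b IH]; first by split=> //; exists [::].
rewrite pairwise_rcons => /andP[sb /IH[s4 [u uP sE]]].
have hb i : i < size s -> adj (inord i) (wact (rev u) b).
  move=> im; rewrite -(adj_wact uP) wactKV //.
  apply: (allP sb); rewrite sE; apply/mapP; exists i => //.
  by rewrite mem_iota.
have {}hb (i : gen) : i < size s -> adj i (wact (rev u) b).
  by move/hb; rewrite inord_val.
rewrite size_rcons; move: s4; rewrite leq_eqVlt => /orP[/eqP s4|s4].
  by case: (@no_clique5 (wact (rev u) b)) => i i4; apply: hb; rewrite s4.
split=> //; have [v vP bE] := wact_next s4 hb.
exists (u ++ v) => [x|].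
  rewrite mem_cat => /orP[/uP//|/vP].
  rewrite !mem_iota => /andP[/(leq_trans _)->//= /leq_trans->//].
  by rewrite addSn subnKC // ltnW.
rewrite -(addn1 (size s)) iotaD add0n map_cat /= -cats1 {1}sE;
  congr (_ ++ [:: _]).
  apply/eq_in_map => i; rewrite mem_iota /= => im.
  rewrite /wact foldr_cat -/(wact v _) (wact_fix s4 vP) // inordK //.
  by apply: ltn_trans im (leq_trans s4 _).
by rewrite /wact foldr_cat -/(wact v _) -/(wact u _) -bE wactKV.
Qed.

(** * Cliques and their links *)

Definition clique (K : {set gen}) : bool :=
  [forall i in K, forall j in K, (i != j) ==> adj i j].

Definition link (A : {set gen}) : {set gen} :=
  [set i | [forall j in A, adj i j]].

Definition tetra (K : {set gen}) : bool := clique K && (#|K| == 4).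

Lemma cliqueP (K : {set gen}) :
  reflect {in K &, forall i j, i != j -> adj i j} (clique K).
Proof.
apply: (iffP idP) => [/forall_inP h i j iK jK ij|h].
  by have /forall_inP/(_ j jK)/implyP := h i iK; apply.
by apply/forall_inP => i iK; apply/forall_inP => j jK; apply/implyP; apply: h.
Qed.

Lemma linkP (A : {set gen}) i :
  reflect {in A, forall j, adj i j} (i \in link A).
Proof. by rewrite inE; apply: forall_inP. Qed.

Lemma sub_clique (J K : {set gen}) : J \subset K -> clique K -> clique J.
Proof.
by move=> /subsetP JK /cliqueP h; apply/cliqueP => i j /JK iK /JK; apply: h.
Qed.

Lemma link_notin (A : {set gen}) i : i \in link A -> i \notin A.
Proof. by move/linkP => h; apply/negP => /h; rewrite adj_irr. Qed.

Lemma link0 : link set0 = setT.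
Proof. by apply/setP => i; rewrite in_setT; apply/linkP => j; rewrite inE. Qed.

Lemma linkU (A B : {set gen}) : link (A :|: B) = link A :&: link B.
Proof.
apply/setP => i; rewrite in_setI; apply/linkP/andP => [h|[/linkP a /linkP b] j].
  by split; apply/linkP => j jA; apply: h; rewrite inE jA ?orbT.
by rewrite inE => /orP[/a|/b].
Qed.

Lemma link1 i j : (i \in link [set j]) = adj i j.
Proof.
by apply/linkP/idP => [|a k]; [apply; rewrite inE|rewrite inE => /eqP->].
Qed.

Lemma linkS (A B : {set gen}) : A \subset B -> link B \subset link A.
Proof. by move/setUidPr => <-; rewrite linkU subsetIl. Qed.

Lemma cliqueU1 i (K : {set gen}) : clique K -> i \in link K -> clique (i |: K).
Proof.
move=> /cliqueP cK /linkP iK; apply/cliqueP => x y.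
rewrite !inE => /orP[/eqP->|xK] /orP[/eqP->|yK]; rewrite ?eqxx // => xy.
- exact: iK.
- by rewrite adj_sym; apply: iK.
exact: cK.
Qed.

Lemma clique_link i (K : {set gen}) :
  clique K -> i \in K -> i \in link (K :\ i).
Proof.
by move=> /cliqueP cK iK; apply/linkP => j; rewrite !inE eq_sym => /andP[ij jK];
   apply: cK.
Qed.

Definition std (p q : nat) : {set gen} := [set i : gen | val i \in iota p q].

Lemma mem_std p q (i : gen) : (i \in std p q) = (p <= i < p + q).
Proof. by rewrite inE mem_iota. Qed.

Lemma card_std p q : p + q <= 120 -> #|std p q| = q.
Proof.
move=> pq; rewrite count_gen -[RHS](size_iota p q) -size_filter.
apply/perm_size/uniq_perm => [||x]; rewrite ?filter_uniq ?iota_uniq //.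
rewrite mem_filter; apply: andb_idr => xpq; have: x \in iota p q := xpq.
by rewrite !mem_iota add0n => /andP[_ /leq_trans->].
Qed.

Lemma std4_tetra : tetra (std 0 4).
Proof.
rewrite /tetra card_std // eqxx andbT; apply/cliqueP => i j i4 j4 ij.
have /allP/(_ i) : all (fun i => all (fun j => (i != j) ==> gadj i j)
  (iota 0 4)) (iota 0 4) by vm_compute.
rewrite mem_iota -mem_std => /(_ i4)/allP/(_ j).
by rewrite mem_iota -mem_std => /(_ j4)/implyP/(_ ij).
Qed.

Lemma std4_clique k : k <= 4 -> clique (std 0 k).
Proof.
move=> k4; have /andP[c4 _] := std4_tetra; apply: sub_clique c4.
by apply/subsetP => i; rewrite !mem_std => /leq_trans->.
Qed.

Lemma clique_wact u (K : {set gen}) : {subset u <= iota 1 4} -> clique K ->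
  clique (wact u @: K).
Proof.
move=> uP /cliqueP cK; apply/cliqueP => _ _ /imsetP[i iK ->] /imsetP[j jK ->].
by rewrite (inj_eq (wact_inj uP)) (adj_wact uP); apply: cK.
Qed.

Lemma pairwise_adj (s : seq gen) : uniq s ->
  {in s &, forall i j, i != j -> adj i j} -> pairwise adj s.
Proof.
elim: s => //= x s IH /andP[xs us] h; apply/andP; split.
  apply/allP => y ys; apply: h; rewrite ?inE ?eqxx ?ys ?orbT //.
  by apply: contraNneq xs => ->.
by apply: IH => // i j si sj; apply: h; rewrite inE ?si ?sj orbT.
Qed.

(** Listing A before B makes one flag of the pair, so a symmetry-invariant count attached to A and B
    depends only on their sizes. *)
Lemma clique_orbit (A B : {set gen}) : clique (A :|: B) -> [disjoint A & B] ->
  #|A| + #|B| <= 4 /\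
  exists2 u, {subset u <= iota 1 4} &
    A = wact u @: std 0 #|A| /\ B = wact u @: std #|A| #|B|.
Proof.
move=> /cliqueP c dis.
have /flag_transitive[] : pairwise adj (enum A ++ enum B).
  apply: pairwise_adj => [|i j].
    rewrite cat_uniq !enum_uniq /= andbT; apply/hasPn => x.
    rewrite !mem_enum => xB; apply/negP => xA.
    by move/pred0P/(_ x): dis; rewrite /= xA xB.
  by rewrite !mem_cat !mem_enum => iA jA; apply: c; rewrite inE.
rewrite size_cat -!cardE => s4 [u uP]; rewrite iotaD add0n map_cat => /eqP.
rewrite eqseq_cat ?size_map ?size_iota -?cardE // => /andP[/eqP EA /eqP EB].
split=> //; exists u => //.
have h p q (C : {set gen}) : enum C = [seq wact u (inord i) | i <- iota p q] ->
    p + q <= 4 -> C = wact u @: std p q.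
  move=> CE pq; apply/setP => x; rewrite -mem_enum CE.
  apply/mapP/imsetP => [[i ipq ->]|[i]].
    exists (inord i) => //; rewrite mem_std.
    move: ipq; rewrite mem_iota => /andP[pi ipq]; rewrite inordK ?pi //.
    by apply: leq_trans ipq (leq_trans pq _).
  by rewrite mem_std -mem_iota => ipq ->; exists (val i); rewrite ?inord_val.
by split; apply: h => //; apply: leq_trans s4; apply: leq_addr.
Qed.

Definition link_table (p q j : nat) : nat :=
  count (fun s => [&& all (gadj s) (iota 0 p), s \notin iota p q &
                      count (gadj s) (iota p q) == j]) (iota 0 120).

Lemma card_adj_std (s : gen) p q : p + q <= 120 ->
  #|[set t in std p q | adj s t]| = count (gadj s) (iota p q).
Proof.
move=> pq; rewrite -[RHS]size_filter.
have -> : [set t in std p q | adj s t] =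
          [set t : gen | (val t \in iota p q) && gadj s t].
  by apply/setP => t; rewrite !inE.
rewrite (count_gen (fun t => (t \in iota p q) && gadj s t)) -size_filter.
apply/perm_size/uniq_perm => [||x].
- by rewrite filter_uniq ?iota_uniq.
- by rewrite filter_uniq ?iota_uniq.
rewrite !mem_filter -andbA andbCA; congr (_ && _).
by apply: andb_idr => xpq; have: x \in iota p q := xpq;
  rewrite !mem_iota add0n => /andP[_ /leq_trans->].
Qed.

Lemma link_count (A B : {set gen}) j : clique (A :|: B) -> [disjoint A & B] ->
  #|[set s in link A | (s \notin B) && (#|[set t in B | adj s t]| == j)]| =
  link_table #|A| #|B| j.
Proof.
move=> c dis; have [s4 [u uP [EA EB]]] := clique_orbit c dis.
set p := #|A| in s4 EA EB *; set q := #|B| in s4 EB *.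
have pq120 : p + q <= 120 by apply: leq_trans s4 _.
have p120 : 0 + p <= 120 by apply: leq_trans pq120; rewrite leq_addr.
have inj := wact_inj uP.
rewrite /link_table -count_gen -(card_imset _ inj).
apply: eq_card => s; rewrite -(wactKV uP s) mem_imset //;
  set t := wact (rev u) s.
rewrite !inE; congr [&& _, _ & _].
- rewrite EA; apply/forall_inP/allP => [h x|h y].
    rewrite mem_iota => /andP[_ xp].
    have x120 : x < 120 by apply: leq_trans p120.
    rewrite -[gadj t x]/(adj t (Ordinal x120)) -(adj_wact uP); apply: h.
    by rewrite imset_f // mem_std.
  by case/imsetP => x; rewrite inE => xp ->; rewrite adj_wact //; apply: h.
- by rewrite EB mem_imset // inE.
have -> : [set x in B | adj (wact u t) x] =
          wact u @: [set x in std p q | adj t x].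
  apply/setP => x; rewrite -(wactKV uP x) mem_imset // !in_set EB mem_imset //.
  by rewrite (adj_wact uP) inE.
by rewrite card_imset // card_adj_std.
Qed.

Lemma card_link (A : {set gen}) : clique A ->
  #|A| <= 4 /\ #|link A| = nth 0 [:: 120; 12; 5; 2; 0] #|A|.
Proof.
move=> c; have cA : clique (A :|: set0) by rewrite setU0.
have dis : [disjoint A & set0] by rewrite -setI_eq0 setI0.
have [] := clique_orbit cA dis; rewrite cards0 addn0 => s4 _; split=> //.
have := link_count 0 cA dis; rewrite cards0.
have -> : [set s in link A | (s \notin set0) &&
   (#|[set t in set0 | adj s t]| == 0)] = link A.
  apply/setP => s; rewrite !inE andb_idr // => _; apply/eqP/eq_card0 => t.
  by rewrite !inE.
by move=> ->; case: #|A| s4 => [|[|[|[|[|]]]]] //= _; vm_compute.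
Qed.

Lemma tetra_link0 (K : {set gen}) : tetra K -> link K = set0.
Proof.
by case/andP => c /eqP k4; apply/eqP; rewrite -cards_eq0 (card_link c).2 k4.
Qed.

Lemma tetra_max (K : {set gen}) i : tetra K -> i \notin link K.
Proof. by move/tetra_link0->; rewrite inE. Qed.

Lemma link_ex (J : {set gen}) : clique J -> #|J| < 4 -> exists i, i \in link J.
Proof.
move=> c j4; apply/set0Pn; rewrite -card_gt0 (card_link c).2.
by case: #|J| j4 => [|[|[|[|]]]].
Qed.

Lemma cliqueU1_card i (J : {set gen}) : i \in link J -> #|i |: J| = #|J|.+1.
Proof. by move/link_notin => iJ; rewrite cardsU1 iJ. Qed.

Lemma tetra_ex (J : {set gen}) : clique J -> exists2 K, tetra K & J \subset K.
Proof.
move=> c; have [n] : exists n, #|J| + n = 4.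
  by exists (4 - #|J|); rewrite subnKC // (card_link c).1.
elim: n J c => [|n IH] J c; rewrite ?addn0 => nJ.
  by exists J => //; rewrite /tetra c nJ.
have [|i iJ] := link_ex c; first by apply: leq_trans (eq_leq nJ);
  rewrite addnS ltnS leq_addr.
have [|K tK JK] := IH _ (cliqueU1 c iJ);
  first by rewrite cliqueU1_card ?addSnnS.
by exists K => //; apply: subset_trans JK; apply: subsetUr.
Qed.

(** A triangle has two common neighbours, so across each face of a tetrahedron lies a second one. *)
Lemma tetra_opp (K : {set gen}) i : tetra K -> i \in K ->
  exists i', [/\ i' != i, i' \in link (K :\ i) & tetra (i' |: (K :\ i))].
Proof.
move=> /andP[c /eqP k4] iK.
have cT : clique (K :\ i) by apply: sub_clique c; apply: subsetDl.
have t3 : #|K :\ i| = 3 by move: k4; rewrite (cardsD1 i) iK => -[].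
have := (card_link cT).2; rewrite t3 /= (cardsD1 i) clique_link // add1n =>
  -[l1].
have /card_gt0P[i'] : 0 < #|link (K :\ i) :\ i| by rewrite l1.
rewrite !inE => /andP[ii' i'l];
  have {}i'l : i' \in link (K :\ i) by rewrite inE.
exists i'; split=> //.
by rewrite /tetra cliqueU1 // cliqueU1_card // t3.
Qed.

Lemma tetra_other (J K : {set gen}) : tetra K -> J \subset K -> #|J| < 4 ->
  exists K', [/\ tetra K', J \subset K' & K' != K].
Proof.
move=> tK JK j4; have /andP[c /eqP k4] := tK.
have /subsetPn[i iK iJ] : ~~ (K \subset J).
  by apply/negP => /subset_leq_card; rewrite k4 leqNgt j4.
have [i' [ii' i'l tK']] := tetra_opp tK iK.
exists (i' |: (K :\ i)); split=> //.
  apply/subsetP => x xJ; rewrite !inE (subsetP JK) // andbT.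
  by rewrite orbC; case: eqP xJ => // ->; rewrite (negPf iJ).
by apply/negP => /eqP/setP/(_ i); rewrite !inE eqxx iK eq_sym (negPf ii').
Qed.

(** * Spreading a property through triangles *)

Definition tri_pass (dom s : seq nat) : seq nat :=
  foldl (fun s c => let n := [seq x <- nth [::] gnbrs c | x \in s] in
    if has (fun x => has (gadj x) n) n then rcons s c else s) s dom.

(** Whatever the pass adds completes a triangle over two vertices already present, so it inherits U.
    That one pass from a single edge reaches every vertex is computed where the hulls are used. *)
Lemma tri_passP (U : nat -> Prop) (dom s : seq nat) :
  (forall c x y, c \in dom -> gadj c x -> gadj c y -> gadj x y ->
     U x -> U y -> U c) ->
  (forall x, x \in s -> U x) -> forall x, x \in tri_pass dom s -> U x.
Proof.
move=> UP; rewrite /tri_pass.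
have : {subset dom <= dom} by [].
elim: {1 3}dom s => //= c d IH s cd sU; apply: IH => [z zd|z].
  by apply: cd; rewrite inE zd orbT.
case: ifP => [|_]; last exact: sU.
case/hasP => x; rewrite mem_filter => /andP[xs cx].
case/hasP => y; rewrite mem_filter => /andP[ys cy] xy.
rewrite mem_rcons inE => /orP[/eqP->|]; last exact: sU.
by apply: (UP c x y) => //; [apply: cd; rewrite inE eqxx|apply: sU|apply: sU].
Qed.

Definition tri_hull : seq nat :=
  Eval vm_compute in tri_pass (iota 0 120) [:: 0; 1].

Definition tri_link_hull : seq nat :=
  Eval vm_compute in tri_pass (nth [::] gnbrs 0) [:: 1; 2].

Lemma tri_hullE : tri_hull = tri_pass (iota 0 120) [:: 0; 1].
Proof. by vm_compute. Qed.

Lemma tri_link_hullE :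
  tri_link_hull = tri_pass (nth [::] gnbrs 0) [:: 1; 2].
Proof. by vm_compute. Qed.

Lemma flag_transport (s : seq gen) : pairwise adj s ->
  exists2 u, {subset u <= iota 1 4} &
    forall i, i < size s -> nth (inord 0) s i = wact u (inord i).
Proof.
move=> /flag_transitive[_ [u uP sE]]; exists u => // i si.
by rewrite {1}sE (nth_map 0) ?size_iota // nth_iota.
Qed.

Lemma gadj_ltn i j : i < 120 -> gadj i j -> j < 120.
Proof.
move=> i120; have /allP/(_ i) : all (fun i => all (fun j => j < 120)
  (nth [::] gnbrs i)) (iota 0 120) by vm_compute.
by rewrite mem_iota => /(_ i120)/allP h ij; apply: h.
Qed.

Lemma adj_inord i j : i < 120 -> gadj i j -> adj (inord i) (inord j).
Proof. by move=> i120 ij; rewrite /adj !inordK // (gadj_ltn i120 ij). Qed.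

(** The edges form one orbit, so it suffices that the edge 0, 1 generates the whole 600-cell by
    completing triangles. *)
Lemma adj_propagation (p q : gen) (U : gen -> Prop) : adj p q -> U p -> U q ->
  (forall c x y, adj c x -> adj c y -> adj x y -> U x -> U y -> U c) ->
  forall c, U c.
Proof.
move=> pq Up Uq UP c.
have [|u uP uE] := @flag_transport [:: p; q]; first by rewrite /= pq.
have := uE 0 isT; have := uE 1 isT => /= {uE} q1 p0.
rewrite -(wactKV uP c); set d := wact _ c.
pose V i := U (wact u (inord i)).
have [s [sV]] : exists s : seq nat, (forall x, x \in s -> V x) /\
    all (fun c => c \in s) (iota 0 120).
  exists tri_hull; split; last by vm_compute.
  rewrite tri_hullE.
  apply: (@tri_passP V) => [e x y|x].
  rewrite mem_iota => /= e120 ex ey xy.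
  have x120 := gadj_ltn e120 ex.
  by apply: UP; rewrite (adj_wact uP) adj_inord.
  by rewrite !inE => /orP[] /eqP->; rewrite /V -?p0 -?q1.
by move=> /all_gen/(_ d)/sV; rewrite /V inord_val.
Qed.

(** The analogue inside the icosahedron of neighbours of t: the flags t, p, q form one orbit. *)
Lemma link_propagation (t p q : gen) (U : gen -> Prop) :
  adj t p -> adj t q -> adj p q -> U p -> U q ->
  (forall c x y, adj t c -> adj t x -> adj t y -> adj c x -> adj c y ->
     adj x y -> U x -> U y -> U c) ->
  forall c, adj t c -> U c.
Proof.
move=> tp tq pq Up Uq UP c tc.
have [|u uP uE] := @flag_transport [:: t; p; q]; first by rewrite /= tp tq pq.
have := uE 0 isT; have := uE 1 isT; have := uE 2 isT => /= {uE} q2 p1 t0.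
move: tc; rewrite -(wactKV uP c); set d := wact _ c.
rewrite t0 (adj_wact uP) => {}tc.
pose V i := U (wact u (inord i)) /\ gadj 0 i.
have tE : nat_of_ord (inord 0 : gen) = 0 by rewrite inordK.
have [s [sV]] : exists s : seq nat, (forall x, x \in s -> V x) /\
    all (fun c => gadj 0 c ==> (c \in s)) (iota 0 120).
  exists tri_link_hull; split; last by vm_compute.
  rewrite tri_link_hullE.
  apply: (@tri_passP V) => [e x y|x].
    move=> te ex ey xy [Ux tx] [Uy ty]; split=> //.
    have e120 := gadj_ltn (isT : 0 < 120) te.
    have x120 := gadj_ltn e120 ex.
    by apply: (UP _ _ _ _ _ _ _ _ _ Ux Uy); rewrite ?t0 (adj_wact uP) adj_inord.
  by rewrite !inE => /orP[] /eqP->; rewrite /V -?p1 -?q2.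
move=> /all_gen/(_ d)/implyP h; have /h/sV[] : gadj 0 d.
  by move: tc; rewrite /adj tE.
by rewrite inord_val.
Qed.

(** * Filling the star of a clique by the convexity rule *)

Section Star.

Variable Kn : {set gen} -> Prop.

Definition star (X : {set gen}) :
  Prop := forall K, tetra K -> X \subset K -> Kn K.

Hypothesis Kn_ring : forall K1 K2 K : {set gen}, tetra K1 -> tetra K2 ->
  tetra K -> Kn K1 -> Kn K2 -> #|K1 :&: K2| = 2 -> K1 :&: K2 \subset K -> Kn K.

Lemma starS (X Y : {set gen}) : X \subset Y -> star X -> star Y.
Proof. by move=> XY sX K tK YK; apply: sX => //; apply: subset_trans YK. Qed.

(** The tetrahedra around the edge J form a ring of five, one for each side of the pentagon
    [link J]. The two on either side of the one over pq are known and meet only in J, which is the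
    situation of [Kn_ring]. *)
Lemma star_edge (J : {set gen}) p q : clique J -> #|J| = 2 ->
  p \in link J -> q \in link J -> adj p q ->
  star (p |: J) -> star (q |: J) -> star J.
Proof.
move=> cJ J2 pJ qJ pq sp sq K tK JK.
have hext x y : x \in link J -> y \in link J -> adj x y ->
    exists x', [/\ x' != y, x' \in link (x |: J) & tetra (x' |: (x |: J))].
  move=> xJ yJ xy.
  have yxJ : y \in link (x |: J) by rewrite linkU in_setI yJ link1 adj_sym xy.
  have t : tetra (y |: (x |: J)).
    by rewrite /tetra !cliqueU1 ?cliqueU1_card ?J2.
  have [|x' []] := tetra_opp t (_ : y \in _); first by rewrite !inE eqxx.
  by rewrite setU1K ?link_notin // => *; exists x'.
have [p' [p'q p'J tp]] := hext p q pJ qJ pq.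
have [|q' [q'p q'J tq]] := hext q p qJ pJ; first by rewrite adj_sym.
(* A common neighbour of p and q in the pentagon would give a 5-clique. *)
have p'q' : p' != q'.
  apply/eqP => e; have /tetra_link0/setP/(_ p') : tetra (q |: (p |: J)).
    rewrite /tetra !cliqueU1 ?cliqueU1_card ?J2 //;
      by rewrite linkU in_setI qJ link1 adj_sym pq.
  rewrite in_set0 linkU in_setI p'J andbT link1 => /negP[].
  by move: q'J; rewrite -e linkU in_setI link1 => /andP[].
have sub x y : x |: J \subset y |: (x |: J) by apply: subsetUr.
have KJ : (p' |: (p |: J)) :&: (q' |: (q |: J)) = J.
  apply/eqP; rewrite eqEsubset subsetI; apply/andP; split; last first.
    by rewrite !(subset_trans _ (sub _ _)) // subsetUr.
  apply/subsetP => x; rewrite !inE; case: (x \in J); rewrite ?orbT // !orbF.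
  case/andP=> /orP[]/eqP-> /orP[]/eqP e; move: p'q' p'q q'p pq;
    by rewrite ?e ?eqxx ?adj_irr // -e ?eqxx ?adj_irr.
apply: (Kn_ring tp tq tK); rewrite ?KJ //.
- by apply: sp => //; apply: subsetUr.
- by apply: sq => //; apply: subsetUr.
Qed.

(** When c, x, y form a triangle in the link of t, [star_edge] obtains the edge tc from tx and ty;
    [link_propagation] then covers all edges at t. *)
Lemma star_vertex t p q : adj t p -> adj t q -> adj p q ->
  star (p |: [set t]) -> star (q |: [set t]) -> star [set t].
Proof.
move=> tp tq pq sp sq.
have h : forall c, adj t c -> star (c |: [set t]).
  apply: (link_propagation tp tq pq) => // c x y tc tx ty cx cy xy sx sy.
  have ct z : adj t z -> adj c z -> z \in link (c |: [set t]).
    by move=> tz cz; rewrite linkU in_setI !link1 ![adj z _]adj_sym tz cz.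
  apply: (@star_edge _ x y); rewrite ?ct //.
  - apply: cliqueU1; last by rewrite link1 adj_sym.
    by apply/cliqueP => i j; rewrite !inE => /eqP-> /eqP->; rewrite eqxx.
  - by rewrite cards2; case: eqP tc => // ->; rewrite adj_irr.
  - by apply: starS sx; apply: setUS; apply: subsetUr.
  - by apply: starS sy; apply: setUS; apply: subsetUr.
move=> K tK; rewrite sub1set => tK'; have /andP[/cliqueP c /eqP k4] := tK.
have /card_gt0P[i] : 0 < #|K :\ t| by move: k4;
  rewrite (cardsD1 t) tK' add1n => -[->].
rewrite !inE => /andP[it iK]; apply: (h i _ _ tK).
  by apply: c; rewrite // eq_sym.
by apply/subsetP => x; rewrite !inE => /orP[]/eqP->.
Qed.

(* The tetrahedra of star (K :\ a) span hypercubes at the top vertex of the one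
   spanned by K, which pascal_next adds to P. *)
Definition cross (X : {set gen}) (a : gen) : Prop :=
  forall K, tetra K -> a |: X \subset K -> star (K :\ a).

Lemma crossS (X Y : {set gen}) a : X \subset Y -> cross X a -> cross Y a.
Proof.
by move=> XY h K tK YK; apply: h => //; apply: subset_trans YK; apply: setUS.
Qed.

(* The set of known tetrahedra spreads by the convexity rule: first around the
   edges, then in the icosahedral links of the vertices and finally in the whole
   600-cell, each time through triangles two of whose vertices are known. *)
Lemma star_cross (S : {set gen}) a : clique S -> #|S| < 4 -> a \in link S ->
  star (a |: S) -> cross S a -> star S.
Proof.
(* Removing c from the tetrahedron over b, c and J, [cross] makes the triangle [b |: J] known, next
   to the known triangle [c |: J]. *)
have two J c : clique J -> #|J| = 2 -> c \in link J -> star (c |: J) ->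
    cross J c -> star J.
  move=> cJ J2 cl sc cr; have cc := cliqueU1 cJ cl.
  have [|b bl] := link_ex cc; first by rewrite cliqueU1_card ?J2.
  have tK : tetra (b |: (c |: J)).
    by rewrite /tetra !cliqueU1 ?cliqueU1_card ?J2.
  move: (bl); rewrite linkU in_setI link1 => /andP[bc bJ].
  apply: (@star_edge _ c b) => //; first by rewrite adj_sym.
  have := cr _ tK (subsetUr _ _); congr star.
  rewrite setUCA setU1K // !inE negb_or (link_notin cl) andbT.
  by apply: contraTneq bc => ->; rewrite adj_irr.
have one t c : adj c t -> star (c |: [set t]) -> cross [set t] c ->
    star [set t].
  move=> ct sc cr.
  have c1 : clique [set t].
    by apply/cliqueP => i j; rewrite !inE => /eqP-> /eqP->; rewrite eqxx.
  have cl : c \in link [set t] by rewrite link1.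
  have [|b bl] := link_ex (cliqueU1 c1 cl);
    first by rewrite cliqueU1_card ?cards1.
  move: bl; rewrite linkU in_setI !link1 => /andP[bc bt].
  apply: (@star_vertex t c b) => //; rewrite 1?adj_sym //.
  apply: (two _ c); rewrite ?cliqueU1 ?cliqueU1_card ?link1 ?cards1 //.
  - by rewrite linkU in_setI !link1 adj_sym bc.
  - by apply: starS sc; apply: setUS; apply: subsetUr.
  - by apply: crossS cr; apply: subsetUr.
move=> cS S4 aS sa cr.
case E : #|S| S4 => [|[|[|[|]]]] // _.
(* Here all 600 tetrahedra have to be reached; the vertex a and one of its neighbours start the
   spreading. *)
- have S0 : S = set0 by apply/eqP; rewrite -cards_eq0 E.
  rewrite S0 setU0 in sa cr *.
  have sv t : adj a t -> star [set t].
    move=> t_a; apply: (one t a) => //; first by apply: starS sa;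
      apply: subsetUl.
    by apply: crossS cr; apply: sub0set.
  have [||b] := @link_ex [set a]; rewrite ?cards1 //.
    by apply/cliqueP => i j; rewrite !inE => /eqP-> /eqP->; rewrite eqxx.
  rewrite link1 adj_sym => ab.
  have h : forall c, star [set c].
    apply: (adj_propagation ab sa (sv b ab)) => c x y cx cy xy sx sy.
    by apply: (star_vertex cx cy xy); [apply: starS sx|apply: starS sy];
       apply: subsetUl.
  move=> K tK _; have /andP[_ /eqP k4] := tK.
  have /card_gt0P[i iK] : 0 < #|K| by rewrite k4.
  by apply: (h i) => //; rewrite sub1set.
- have /cards1P[t St] : #|S| == 1 by rewrite E.
  rewrite St in sa cr aS *; apply: (one t a) => //; by rewrite -link1.
- exact: (two _ a).
(* Here S is a triangle: one of its two tetrahedra is [a |: S], and [cross] yields both. *)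
- have tK : tetra (a |: S) by rewrite /tetra cliqueU1 ?cliqueU1_card ?E.
  by have := cr _ tK (subxx _); rewrite setU1K ?link_notin.
Qed.

End Star.

(** * The form and the reflections *)

Require Import Defs.
From mathcomp Require Import finmap.
From mathcomp Require Import all_classical reals.
From mathcomp Require Import ring lra.

Local Open Scope classical_set_scope.
Local Open Scope ring_scope.

Section Form.

Variable R : realType.
Implicit Types x y z u v a : 'rV[R]_5.

Lemma formC x y : form x y = form y x.
Proof.
rewrite /form (mulrC (x 0 0)); congr (_ - _).
by apply: eq_bigr => i _; rewrite mulrC.
Qed.

Lemma formDl x y z : form (x + y) z = form x z + form y z.
Proof.
rewrite /form; move: (_ + 2) => k.
rewrite addrACA -opprD -mulrDr !mxE mulrDl; congr (_ - _).
by rewrite -big_split; apply: eq_bigr => i _; rewrite !mxE mulrDl.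
Qed.

Lemma formZl c x y : form (c *: x) y = c * form x y.
Proof.
rewrite /form; move: (_ + 2) => k.
rewrite mulrBr (mulrCA c) !mxE -!mulrA; congr (_ - _).
by rewrite big_distrr; apply: eq_bigr => i _; rewrite !mxE /= mulrA.
Qed.

Lemma formDr x y z : form x (y + z) = form x y + form x z.
Proof. by rewrite formC formDl !(formC x). Qed.

Lemma formZr c x y : form x (c *: y) = c * form x y.
Proof. by rewrite formC formZl formC. Qed.

Lemma formNl x y : form (- x) y = - form x y.
Proof. by rewrite -scaleN1r formZl mulN1r. Qed.

Lemma formNr x y : form x (- y) = - form x y.
Proof. by rewrite formC formNl formC. Qed.

Lemma formBl x y z : form (x - y) z = form x z - form y z.
Proof. by rewrite formDl formNl. Qed.

Lemma formBr x y z : form x (y - z) = form x y - form x z.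
Proof. by rewrite formDr formNr. Qed.

Lemma form_sumr (I : finType) (P : pred I) (F : I -> 'rV[R]_5) x :
  form x (\sum_(i | P i) F i) = \sum_(i | P i) form x (F i).
Proof.
apply: (big_morph (form x)) => [y z|]; first exact: formDr.
by rewrite -(scale0r 0) formZr mul0r.
Qed.

Lemma form0r x : form x 0 = 0.
Proof. by rewrite -(scale0r 0) formZr mul0r. Qed.

Lemma form_spatial_ge0 x : x 0 0 = 0 -> 0 <= form x x.
Proof.
move=> x0; rewrite /form x0 mul0r mulr0 subr0.
by apply: sumr_ge0 => i _; rewrite -expr2 sqr_ge0.
Qed.

Lemma form_spatial_eq0 x : x 0 0 = 0 -> form x x <= 0 -> x = 0.
Proof.
move=> x0 xx; have {xx} : form x x == 0 by rewrite eq_le xx form_spatial_ge0.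
rewrite /form x0 mul0r mulr0 subr0 psumr_eq0 => [/allP h|i _]; last first.
  by rewrite -expr2 sqr_ge0.
apply/rowP => i; rewrite mxE; have [->//|i0] := eqVneq i 0.
have := h i (mem_index_enum _); rewrite i0 /= -expr2 sqrf_eq0 => /eqP <-.
by congr (x _ _); apply: val_inj.
Qed.

(* The vector u_0 z - z_0 u is spatial. *)
Lemma timelike_orthogonal z u :
  form z z < 0 -> form u u <= 0 -> form z u = 0 -> u = 0.
Proof.
move=> zz uu zu.
have := @form_spatial_ge0 (u 0 0 *: z - z 0 0 *: u).
rewrite !mxE mulrC subrr => /(_ erefl).
rewrite formBl !formBr !formZl !formZr (formC u z) zu !mulr0 subr0 sub0r opprK.
rewrite !mulrA -!expr2 => h.
have u0 : u 0 0 = 0.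
  apply/eqP; rewrite -sqrf_eq0 -[_ == 0]negbK; apply/negP => u0.
  have : u 0 0 ^+ 2 * form z z < 0 by rewrite pmulr_rlt0 // lt_neqAle eq_sym u0
    sqr_ge0.
  have : z 0 0 ^+ 2 * form u u <= 0 by rewrite mulr_ge0_le0 // sqr_ge0.
  by move: h; lra.
exact: form_spatial_eq0 uu.
Qed.

(* Otherwise a positive combination of x and v is timelike and orthogonal
   to u. *)
Lemma causal_sign x v u :
  form x x < 0 -> form v v < 0 -> form x v < 0 -> form u u <= 0 ->
  0 < form x u -> form v u < 0 -> False.
Proof.
move=> xx vv xv uu xu vu.
have u0 : u = 0; last by move: xu; rewrite u0 form0r ltxx.
apply: (@timelike_orthogonal (- form v u *: x + form x u *: v)) => //.
  rewrite formDl !formDr !formZl !formZr (formC v x).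
  have a0 : 0 < - form v u by lra.
  have h1 : - form v u * (- form v u * form x x) < 0 by rewrite !pmulr_rlt0.
  have h2 : form x u * (form x u * form v v) < 0 by rewrite !pmulr_rlt0.
  have h3 : - form v u * (form x u * form x v) < 0 by rewrite !pmulr_rlt0.
  have h4 : form x u * (- form v u * form x v) < 0 by rewrite !pmulr_rlt0.
  by lra.
by rewrite formDl !formZl; ring.
Qed.

Definition isometry (g : 'rV[R]_5 -> 'rV[R]_5) : Prop :=
  linear g /\ forall x y, form (g x) (g y) = form x y.

Lemma reflection_isometry a : form a a != 0 -> isometry (reflection a).
Proof.
move=> a0; split=> [c x y|x y].
  rewrite /reflection formDr formZr.
  by apply/rowP => i; rewrite !mxE; ring.
rewrite /reflection formBl !formBr !formZl !formZr (formC x a); field.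
exact: a0.
Qed.

Lemma reflectionK a : form a a != 0 -> involutive (reflection a).
Proof.
move=> a0 x; rewrite /reflection formBr formZr; apply/rowP => i; rewrite !mxE.
by field.
Qed.

Section Isometry.

Variable g : 'rV[R]_5 -> 'rV[R]_5.
Hypothesis gP : isometry g.

Lemma isoD x y : g (x + y) = g x + g y.
Proof. by rewrite -[x in LHS]scale1r gP.1 scale1r. Qed.

Lemma iso0 : g 0 = 0.
Proof. by have /(congr1 (fun z => z - g 0)) := isoD 0 0;
  rewrite addr0 addrK subrr. Qed.

Lemma isoZ c x : g (c *: x) = c *: g x.
Proof. by rewrite -[c *: x]addr0 gP.1 iso0 addr0. Qed.

Lemma isoN x : g (- x) = - g x.
Proof. by rewrite -scaleN1r isoZ scaleN1r. Qed.

Lemma isoB x y : g (x - y) = g x - g y.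
Proof. by rewrite isoD isoN. Qed.

Lemma iso_sum (I : finType) (P : pred I) (F : I -> 'rV[R]_5) :
  g (\sum_(i | P i) F i) = \sum_(i | P i) g (F i).
Proof. by apply: (big_morph g) => [x y|]; [exact: isoD|exact: iso0]. Qed.

Lemma iso_reflection a x : g (reflection a x) = reflection (g a) (g x).
Proof. by rewrite /reflection isoB isoZ !gP.2. Qed.

End Isometry.

Lemma isometry_comp g h : isometry g -> isometry h -> isometry (g \o h).
Proof.
move=> gP hP; split=> [c x y|x y] /=.
  by rewrite (isoD hP) (isoZ hP) (isoD gP) (isoZ gP).
by rewrite gP.2 hP.2.
Qed.

End Form.

(** * Coordinates in Z[golden] inside the reals *)

Section Embedding.

Variable R : realType.

Definition golden : R := (1 + Num.sqrt 5) / 2.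

Lemma sqrt5_sqr : Num.sqrt 5 * Num.sqrt 5 = 5 :> R.
Proof. by rewrite -expr2 sqr_sqrtr. Qed.

Lemma golden_sqr : golden * golden = golden + 1.
Proof. by rewrite /golden; have := sqrt5_sqr; set s := Num.sqrt 5; move=> h;
  field : h. Qed.

Lemma sqrt5E : Num.sqrt 5 = 2 * golden - 1.
Proof. by rewrite /golden; field. Qed.

Lemma golden_ge1 : 1 <= golden.
Proof.
have : 1 <= Num.sqrt 5 :> R by rewrite -{1}sqrtr1 ler_sqrt ?ler1n.
by rewrite /golden; lra.
Qed.

Definition geval (x : int * int) : R := x.1%:~R + x.2%:~R * golden.

Definition gvec (s : seq (int * int)) : 'rV[R]_5 :=
  \row_(j < 5) geval (nth (0, 0) s j).

Lemma gevalD x y : geval (gadd x y) = geval x + geval y.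
Proof. by rewrite /geval /gadd /= !intrD; ring. Qed.

Lemma gevalB x y : geval (gsub x y) = geval x - geval y.
Proof. by rewrite /geval /gsub /= !intrB; ring. Qed.

Lemma gevalM x y : geval (gmul x y) = geval x * geval y.
Proof.
rewrite /geval /gmul /= !(intrD, intrM) -!/golden.
by ring : golden_sqr.
Qed.

Lemma form_coords (x y : 'rV[R]_5) : form x y =
  x 0 (inord 1) * y 0 (inord 1) + (x 0 (inord 2) * y 0 (inord 2) +
  (x 0 (inord 3) * y 0 (inord 3) + x 0 (inord 4) * y 0 (inord 4)))
  - (2 * golden + 1) * (x 0 (inord 0) * y 0 (inord 0)).
Proof.
rewrite /form sqrt5E; congr (_ - _); last first.
  by congr (_ * (x _ _ * y _ _)); [ring|..]; apply: val_inj; rewrite /= inordK.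
rewrite big_mkcond !big_ord_recl big_ord0 /= add0r addr0.
by congr (_ * _ + (_ * _ + (_ * _ + _ * _))); congr (_ _ _);
  apply: val_inj; rewrite /= inordK.
Qed.


Lemma gvecE s k : (k < 5)%N -> gvec s 0 (inord k) = geval (nth (0, 0) s k).
Proof. by move=> k5; rewrite mxE inordK. Qed.

Lemma gvec_form x y : form (gvec x) (gvec y) = geval (gdot x y).
Proof.
rewrite form_coords !gvecE // /gdot.
rewrite gevalB !gevalM !gevalD !gevalM /=.
by rewrite /geval /=; ring.
Qed.

Lemma row5P (x y : 'rV[R]_5) :
  (forall k, (k < 5)%N -> x 0 (inord k) = y 0 (inord k)) -> x = y.
Proof. by move=> h; apply/rowP => j; rewrite -(inord_val j); apply: h. Qed.

Lemma vec5E (s : seq R) k : (k < 5)%N -> vec5 s 0 (inord k) = s`_k.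
Proof. by move=> k5; rewrite mxE inordK. Qed.


Lemma simple_norm a : a \in simple_roots R -> form a a != 0.
Proof.
rewrite !inE => /or4P[||| /orP[]] /eqP->; rewrite form_coords !vec5E //=;
  apply: lt0r_neq0; rewrite ?sqrt5E; have := golden_ge1; have := golden_sqr;
    nra.
Qed.

Lemma reflectionE (a x : 'rV[R]_5) i j :
  reflection a x i j = x i j - 2 * form a x / form a a * a i j.
Proof. by rewrite /reflection; move: (_ / _) => c; rewrite !mxE. Qed.

Lemma simple_reflection k x : k \in iota 1 4 ->
  reflection (nth 0 (simple_roots R) k) (gvec x) = gvec (grefl k x).
Proof.
have g2 := golden_sqr; have s5 := sqrt5E.
(* For the last simple root a, [form a a] is 4 - 2 * golden; the quotient is 1 + golden, which is
   why [grefl] stays in Z[golden]. *)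
have inv : 2 * (4 - 2 * golden)^-1 = 1 + golden.
  have e : (4 - 2 * golden) * (1 + golden) = 2 by ring: g2.
  have n0 : 4 - 2 * golden != 0.
    by apply: contra_eq_neq e => ->; rewrite mul0r eq_sym pnatr_eq0.
  by apply: (mulfI n0); rewrite e mulrCA divff // mulr1.
rewrite !inE => /or4P[] /eqP-> /=; apply: row5P => j j5;
  rewrite reflectionE !form_coords !vec5E ?gvecE //= ?s5;
  last set a := nth (0, 0) x 0; last set b := nth (0, 0) x 4;
  last (have -> : 0 * 0 + (0 * 0 + (0 * 0 + -1 * -1)) - (2 * golden + 1) *
    ((2 - (2 * golden - 1)) * (2 - (2 * golden - 1))) = 4 - 2 * golden
    by ring: g2);
  last rewrite (mulrAC 2) inv;
  case: j j5 => [|[|[|[|[|]]]]] //= _; rewrite ?gevalD ?gevalM ?gevalB;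
  try by field.
all: rewrite /geval -/(geval _) -/(geval _) /=.
all: by ring: g2.
Qed.
End Embedding.

(** * The 120 reflections inside the symmetry group *)

Section Words.

Variable R : realType.
Local Notation row := 'rV[R]_5.

Definition rt (i : gen) : row := gvec R (groot i).
Definition corner : row := gvec R (nseq 5 (1, 0)).

Lemma rt_norm i : form (rt i) (rt i) = 1.
Proof.
rewrite gvec_form; have [/implyP/(_ (eqxx _))/eqP-> _ _] := groot_gram (ltn_ord
  i) (ltn_ord i).
by rewrite /geval mul0r addr0.
Qed.

Lemma rt_neq0 i : form (rt i) (rt i) != 0.
Proof. by rewrite rt_norm oner_neq0. Qed.

Lemma rt_adj i j : adj i j -> form (rt i) (rt j) = 0.
Proof.
move=> ij; rewrite gvec_form.
have [_ /implyP/(_ ij)/andP[_ /eqP->] _] := groot_gram (ltn_ord i) (ltn_ord j).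
by rewrite /geval mul0r addr0.
Qed.

Lemma rt_far i j : i != j -> ~~ adj i j -> form (rt i) (rt j) <= -1.
Proof.
move=> ij ij'; rewrite gvec_form.
have [_ _] := groot_gram (ltn_ord i) (ltn_ord j).
case: (gdot _ _) => a b.
rewrite -[gadj i j]/(adj i j) (negPf ij') -[_ == _]/(i == j) (negPf ij) /= =>
  /andP[a0 b0].
have a0' : a%:~R <= 0 :> R by rewrite lerz0.
have b0' : b%:~R <= -1 :> R.
  by rewrite -[-1]/((-1)%:~R) ler_int -ltzD1 addrC subrr.
rewrite /geval /=; have := golden_ge1 R; nra.
Qed.

Lemma rt_le0 i j : i != j -> form (rt i) (rt j) <= 0.
Proof.
move=> ij; have [/rt_adj->//|/(rt_far ij)] := boolP (adj i j).
by move/le_trans; apply; rewrite oppr_le0 ler01.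
Qed.

Lemma rt_corner i : form corner (rt i) = 1.
Proof.
rewrite gvec_form; have /all_gen/(_ i)/eqP-> : all (fun i =>
  gdot (nseq 5 (1, 0)) (groot i) == (1, 0)) (iota 0 120) by vm_compute.
by rewrite /geval mul0r addr0.
Qed.

Lemma corner_timelike : form corner corner < 0.
Proof.
rewrite gvec_form (_ : gdot _ _ = (3, -2)); last by vm_compute.
by rewrite /geval /=; have := golden_ge1 R; have := golden_sqr R; nra.
Qed.

(** The last letter acts first, so appending i to w crosses the wall i of the vertex [act w corner]:
    words are walks from the corner. *)
Definition act (w : seq gen) (x : row) : row :=
  foldr (fun i => reflection (rt i)) x w.

Lemma act_cat v w x : act (v ++ w) x = act v (act w x).
Proof. by rewrite /act foldr_cat. Qed.

Lemma act_rcons w i x : act (rcons w i) x = act w (reflection (rt i) x).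
Proof. by rewrite /act foldr_rcons. Qed.

Lemma act_iso w : isometry (act w).
Proof.
elim: w => [|i w IH]; first by split.
exact: (isometry_comp (reflection_isometry (rt_neq0 i)) IH).
Qed.

Lemma actK w : cancel (act w) (act (rev w)).
Proof.
elim: w => // i w IH x; rewrite rev_cons act_rcons /= reflectionK ?rt_neq0 //.
Qed.

Lemma actKV w : cancel (act (rev w)) (act w).
Proof. by move=> x; rewrite -{1}(revK w) actK. Qed.

Definition simple_act (u : seq nat) (x : row) : row :=
  foldr (fun k => reflection (nth 0 (simple_roots R) k)) x u.

Lemma simple_act_rt u i : {subset u <= iota 1 4} ->
  simple_act u (rt i) = rt (wact u i).
Proof.
elim: u => //= k u IH uP; rewrite IH => [|z zu]; last by apply: uP;
  rewrite inE zu orbT.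
have kP : k \in iota 1 4 by apply: uP; rewrite inE eqxx.
by rewrite simple_reflection // (groot_gperm kP (ltn_ord _)).1 -val_gact.
Qed.

Lemma simple_act_corner u : {subset u <= iota 1 4} ->
  simple_act u corner = corner.
Proof.
elim: u => //= k u IH uP; rewrite IH => [|z zu]; last by apply: uP;
  rewrite inE zu orbT.
have kP : k \in iota 1 4 by apply: uP; rewrite inE eqxx.
rewrite simple_reflection //; congr gvec; apply/eqP.
have /allP/(_ k kP)// : all (fun k => grefl k (nseq 5 (1, 0)) == nseq 5 (1, 0))
  (iota 1 4) by vm_compute.
Qed.

Definition reduce (w : seq row) (x : row) : row := foldr (@reflection R) x w.

Lemma reduce_iso w : {subset w <= simple_roots R} -> isometry (reduce w).
Proof.
elim: w => [|a w IH] wP; first by split.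
apply: (@isometry_comp R (reflection a) (reduce w)).
  by apply/reflection_isometry/simple_norm/wP; rewrite inE eqxx.
by apply: IH => z zw; apply: wP; rewrite inE zw orbT.
Qed.

Lemma reduceK w : {subset w <= simple_roots R} ->
  cancel (reduce w) (reduce (rev w)).
Proof.
elim: w => // a w IH wP x; rewrite rev_cons /reduce foldr_rcons /=.
rewrite reflectionK; last by apply/simple_norm/wP; rewrite inE eqxx.
by apply: IH => z zw; apply: wP; rewrite inE zw orbT.
Qed.

Lemma symmetry_iso (g : row -> row) : mosaic_symmetry g -> isometry g.
Proof. by case=> w wP ->; apply: reduce_iso. Qed.

Lemma symmetry_inv (g : row -> row) : mosaic_symmetry g ->
  exists g', [/\ mosaic_symmetry g', cancel g g' & cancel g' g].
Proof.
case=> w wP ->; have rP : {subset rev w <= simple_roots R}.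
  by move=> a; rewrite mem_rev; apply: wP.
exists (reduce (rev w)); split; [by exists (rev w)|exact: reduceK|].
by move=> x; have := reduceK rP x; rewrite revK.
Qed.

Lemma symmetry_comp (g h : row -> row) :
  mosaic_symmetry g -> mosaic_symmetry h -> mosaic_symmetry (g \o h).
Proof.
case=> v vP -> [w wP ->]; exists (v ++ w) => [a|].
  by rewrite mem_cat => /orP[/vP|/wP].
by apply/funext => x /=; rewrite foldr_cat.
Qed.

Lemma simple_act_symmetry u : {subset u <= iota 1 4} ->
  mosaic_symmetry (simple_act u).
Proof.
move=> uP; exists [seq nth 0 (simple_roots R) k | k <- u] =>
  [a /mapP[k ku ->]|].
  by apply: mem_nth; have := uP k ku; rewrite mem_iota => /andP[].
by apply/funext => x; rewrite foldr_map.
Qed.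

Lemma simple_root0 : nth 0 (simple_roots R) 0 = rt ord0.
Proof.
apply: row5P => k k5; rewrite vec5E // gvecE //.
by case: k k5 => [|[|[|[|[|]]]]] //= _; rewrite /geval mul0r addr0.
Qed.

Lemma flag1 (i : gen) : exists2 u, {subset u <= iota 1 4} & i = wact u ord0.
Proof.
have [//|_ [u uP [iE]]] := @flag_transitive [:: i]; exists u => //.
by rewrite {1}iE; congr wact; apply: val_inj; rewrite /= inordK.
Qed.

(** The stabilizer of the corner is transitive on the 120 normals, so each of these reflections is
    conjugate to the one in the first simple root. *)
Lemma rt_symmetry i : mosaic_symmetry (reflection (rt i)).
Proof.
have [u uP ->] := flag1 i; rewrite -simple_act_rt //.
have [g' [g'P gK g'K]] := symmetry_inv (simple_act_symmetry uP).
have -> : reflection (simple_act u (rt ord0)) =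
          simple_act u \o (reflection (rt ord0) \o g').
  apply/funext => x /=; rewrite (iso_reflection (symmetry_iso
    (simple_act_symmetry uP))).
  by rewrite g'K.
apply: symmetry_comp; first exact: simple_act_symmetry.
apply: symmetry_comp => //; exists [:: rt ord0] => // a; rewrite inE => /eqP->.
by rewrite -simple_root0 mem_nth.
Qed.

Lemma act_symmetry w : mosaic_symmetry (act w).
Proof.
elim: w => [|i w IH]; first by exists [::].
exact: (symmetry_comp (rt_symmetry i) IH).
Qed.

(* The reflections in the roots generate a normal subgroup, complemented by the
   stabilizer of the corner. *)
Lemma symmetry_factor (g : row -> row) : mosaic_symmetry g ->
  exists w u, {subset u <= iota 1 4} /\ g = act w \o simple_act u.
Proof.
case=> s sP ->; elim: s sP => [|a s IH] sP.
  by exists [::], [::].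
have [|w [u [uP E]]] := IH _; first by move=> z zs; apply: sP;
  rewrite inE zs orbT.
have /(nthP 0)[k k5 <-] : a \in simple_roots R by apply: sP; rewrite inE eqxx.
case: k k5 => [_|k k4].
  exists (ord0 :: w), u; split=> //; apply/funext => x /=.
  by rewrite -simple_root0 -[foldr _ _ _]/((fun x =>
    foldr (@reflection R) x s) x) E.
have kP : k.+1 \in iota 1 4 by rewrite mem_iota.
exists (map (gact k.+1) w), (k.+1 :: u); split.
  by move=> z; rewrite inE => /orP[/eqP->|/uP].
apply/funext => x /=; rewrite -[foldr _ _ s]/((fun x =>
  foldr (@reflection R) x s) x) E /=.
elim: w {E} (simple_act u x) => //= i w IHw y; rewrite -IHw.
rewrite iso_reflection; last first.
  exact: (reflection_isometry (simple_norm (mem_nth 0 k4))).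
congr (reflection _ _); apply: (@simple_act_rt [:: k.+1]) => z.
by rewrite inE => /eqP->.
Qed.

End Words.

(** * Reduced words *)

Section BaseCell.

Variable R : realType.
Local Notation row := 'rV[R]_5.

Definition rt_sum (A : {set gen}) : row := \sum_(i in A) rt R i.

Lemma rt_unit (i : gen) k : (i < 4)%N -> (k < 5)%N ->
  rt R i 0 (inord k) = (i.+1 == k)%:R.
Proof.
move=> i4 k5; rewrite gvecE //; case: i i4 => /= i _.
by case: i => [|[|[|[|]]]] // _; case: k k5 => [|[|[|[|[|]]]]] // _;
  rewrite /geval /= mul0r addr0.
Qed.

Lemma rt_sum_unit (A : {set gen}) k : A \subset std 0 4 -> (k < 5)%N ->
  rt_sum A 0 (inord k) = ((0 < k)%N && (inord k.-1 \in A))%:R.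
Proof.
move=> A4 k5; rewrite summxE.
have lt4 i : i \in A -> (i < 4)%N.
  by move/(fintype.subsetP A4); rewrite mem_std add0n => /andP[].
case: k k5 => [|k] k5 /=.
  by apply: big1 => i /lt4 i4; rewrite rt_unit.
have k120 : (k < 120)%N by apply: leq_trans (ltnW k5) _.
case: (boolP (_ \in A)) => kA.
  rewrite (bigD1 _ kA) /= rt_unit ?lt4 // inordK // eqxx big1 ?addr0 //.
  move=> i /andP[/lt4 i4 ik]; rewrite rt_unit // eqSS.
  by case: (val i =P k) ik => // <-; rewrite inord_val eqxx.
apply: big1 => i iA; rewrite rt_unit ?lt4 // eqSS.
by case: (val i =P k) kA => // <-; rewrite inord_val iA.
Qed.

(** Coordinate 0 is time, so direction i changes the sign of coordinate i.+1; hence the shift by one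
    between directions and coordinates. *)
Lemma base_cellE k (x : row) : (k <= 4)%N -> base_cell k x <->
  exists2 A : {set gen}, A \subset std 0 k & x = corner R - 2 *: rt_sum A.
Proof.
move=> k4; have c1 j : (j < 5)%N -> corner R 0 (inord j) = 1.
  move=> j5; rewrite gvecE // nth_nseq j5.
  by rewrite /geval mul0r addr0.
have coord (A : {set gen}) j : A \subset std 0 k -> (j < 5)%N ->
    (corner R - 2 *: rt_sum A) 0 (inord j) =
    1 - 2 * ((0 < j)%N && (inord j.-1 \in A))%:R.
  move=> Ak j5; have A4 : A \subset std 0 4.
    apply: fintype.subset_trans Ak _; apply/fintype.subsetP => i;
      rewrite !mem_std !add0n /=.
    by move/leq_trans; apply.
  by rewrite -rt_sum_unit // -(c1 _ j5); move: (rt_sum A) (corner R) => a b;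
    rewrite !mxE.
split=> [xP|[A Ak ->] i]; last first.
  rewrite -(inord_val i) coord // inordK //.
  case: (boolP ((0 < i)%N && _)) => [/andP[i0 iA]|_]; last by left;
    rewrite mulr0 subr0.
  right; split; last by rewrite mulr1; ring.
  have := fintype.subsetP Ak _ iA; rewrite mem_std add0n inordK; last first.
    by apply: leq_ltn_trans (leq_pred _) (leq_trans (ltn_ord i) _).
  by case: (val i) i0.
pose A := finset (fun i : gen => (i < k)%N && (x 0 (inord i.+1) == -1)).
have Ak : A \subset std 0 k.
  by apply/fintype.subsetP => i; rewrite inE mem_std => /andP[].
exists A => //; apply: row5P => j j5; rewrite coord //.
case: j j5 => [|j] j5 /=.
  rewrite mulr0 subr0; have [//|[]] := xP (inord 0).
  by rewrite inordK.
have j120 : (j < 120)%N by apply: leq_trans (ltnW j5) _.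
rewrite inE inordK //; have [xj|[]] := xP (inord j.+1).
  rewrite xj -subr_eq0 opprK -[1 + 1]/(2%:R) pnatr_eq0 andbF.
  by rewrite mulr0 subr0.
by rewrite inordK //= => jk ->; rewrite jk eqxx mulr1; ring.
Qed.

End BaseCell.

(** * Walls, reduced words and simple transitivity *)

Section Reduced.

Variable R : realType.
Local Notation row := 'rV[R]_5.
Implicit Types w v : seq gen.

(* The sign of side w i tells on which side of the i-th wall at the vertex
   act w corner the corner lies. *)
Definition side w (i : gen) : R := form (corner R) (act w (rt R i)).

Lemma act_rcons_rt w i j :
  act (rcons w i) (rt R j) =
  act w (rt R j) - (2 * form (rt R i) (rt R j)) *: act w (rt R i).
Proof.
have aw := act_iso R w.
by rewrite act_rcons /reflection rt_norm divr1 (isoB aw) (isoZ aw).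
Qed.

Lemma act_rcons_corner w i :
  act (rcons w i) (corner R) = act w (corner R) - 2 *: act w (rt R i).
Proof.
have aw := act_iso R w.
by rewrite act_rcons /reflection rt_norm divr1 formC rt_corner mulr1 (isoB aw)
  (isoZ aw).
Qed.

Lemma side_rcons w i j :
  side (rcons w i) j = side w j - 2 * form (rt R i) (rt R j) * side w i.
Proof. by rewrite /side act_rcons_rt formBr formZr. Qed.

Lemma side_rcons_id w i : side (rcons w i) i = - side w i.
Proof. by rewrite side_rcons rt_norm; ring. Qed.

Lemma side_rcons_adj w i j : adj i j -> side (rcons w i) j = side w j.
Proof. by move=> ij; rewrite side_rcons rt_adj //; ring. Qed.

Inductive reduced : seq gen -> Prop :=
| reduced_nil : reduced [::]
| reduced_rcons w i : reduced w -> 0 < side w i -> reduced (rcons w i).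

Lemma side_nil i : side [::] i = 1.
Proof. by rewrite /side /= rt_corner. Qed.

(** Each letter lowers the form by twice its positive [side]. The equality case says that a reduced
    word fixing the corner is empty. *)
Lemma reduced_time w : reduced w ->
  form (corner R) (act w (corner R)) <= form (corner R) (corner R) ?= iff (w ==
    [::]).
Proof.
elim=> [|v i rv IH si]; first exact/leif_refl.
have -> : (rcons v i == [::]) = false by case: v {rv IH si}.
rewrite act_rcons_corner formBr formZr -/(side v i).
apply/leifP; have := IH.1; move: si; lra.
Qed.

(* The half-spaces beyond two walls that are not orthogonal are disjoint: the
   sum of the two normals is causal. *)
Lemma reduced_sides w i j : reduced w -> side w i < 0 -> side w j <= 0 ->
  i = j \/ adj i j.
Proof.
move=> rw wi wj; have [->|ij] := eqVneq i j; first by left.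
right; apply/negPn/negP => /(rt_far R ij) far; have aw := act_iso R w.
apply: (@causal_sign R (act w (corner R)) (corner R) (act w (rt R i + rt R j))).
- by rewrite aw.2 corner_timelike.
- exact: corner_timelike.
- by rewrite formC; apply: le_lt_trans (reduced_time rw).1 (corner_timelike R).
- rewrite aw.2 formDl !formDr !rt_norm (formC (rt R j)); lra.
- by rewrite aw.2 formDr !rt_corner; lra.
by rewrite (isoD aw) formDr; move: wi wj; rewrite /side; lra.
Qed.

Lemma side_rcons_far w i j : reduced (rcons w i) -> 0 < side w i -> i != j ->
  ~~ adj i j -> 0 < side (rcons w i) j.
Proof.
move=> r wi ij ij'; rewrite ltNge; apply/negP => h.
have si : side (rcons w i) i < 0 by rewrite side_rcons_id oppr_lt0.
case: (reduced_sides r si h) => [e|a]; last by rewrite a in ij'.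
by rewrite e eqxx in ij.
Qed.

(** No wall at a vertex passes through the corner: an ascending step i negates the side of i, keeps
    the sides adjacent to i and makes all others positive. *)
Lemma reduced_side_neq0 w j : reduced w -> side w j != 0.
Proof.
move=> rw; elim: rw j => [j|v i rv IH si j];
  first by rewrite side_nil oner_neq0.
have [<-|ij] := eqVneq i j; first by rewrite side_rcons_id oppr_eq0.
have [a|a] := boolP (adj i j); first by rewrite side_rcons_adj.
by rewrite gt_eqF // side_rcons_far //; apply: reduced_rcons.
Qed.

Lemma side_rcons_lt0 w i j : reduced w -> 0 < side w i ->
  (side (rcons w i) j < 0) = (j == i) || (adj i j && (side w j < 0)).
Proof.
move=> rw wi; have [->|ij] := eqVneq j i.
  by rewrite side_rcons_id oppr_lt0 wi.
have [a|a] := boolP (adj i j); first by rewrite side_rcons_adj.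
apply/negbTE; rewrite -leNgt ltW // side_rcons_far //.
  exact: reduced_rcons.
by rewrite eq_sym.
Qed.

(** A descending letter i occurs in the word and commutes with all later letters; moved to the end,
    it cancels against the appended i. *)
Lemma reduced_exchange w i : reduced w -> side w i < 0 ->
  exists2 v, reduced v & act (R:=R) v =1 act (rcons w i).
Proof.
move=> rw; elim: rw i => [i|v q rv IH vq i]; first by rewrite side_nil ltr10.
rewrite side_rcons_lt0 // => /orP[/eqP->|/andP[qi /IH[v' rv' v'E]]].
  by exists v => // x; rewrite !act_rcons reflectionK ?rt_neq0.
exists (rcons v' q).
  apply: reduced_rcons => //; rewrite /side v'E -/(side _ _) side_rcons_adj //.
  by rewrite adj_sym.
move=> x; rewrite act_rcons v'E !act_rcons; congr act.
have iq := @iso_reflection R _ (reflection_isometry (rt_neq0 R i)) (rt R q) x.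
rewrite iq; congr (reflection _ _).
by rewrite /reflection (formC (rt R i)) rt_adj // mulr0 mul0r scale0r subr0.
Qed.

Lemma reduced_ex w : exists2 v, reduced v & act (R:=R) v =1 act w.
Proof.
elim/last_ind: w => [|w i [v rv vE]]; first by exists [::] => //; constructor.
have vi : act (R:=R) (rcons v i) =1 act (rcons w i).
  by move=> x; rewrite !act_rcons vE.
have [si|si|/eqP] := ltgtP (side v i) 0;
  last by rewrite (negPf (reduced_side_neq0 _ rv)).
  have [v' rv' v'E] := reduced_exchange rv si.
  by exists v' => // x; rewrite v'E vi.
by exists (rcons v i) => //; apply: reduced_rcons.
Qed.

(** [rev v ++ w] fixes the corner, hence reduces to the empty word. Thus a vertex determines the
    labelling of its edges by the 120 directions. *)
Lemma act_corner_inj v w :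
  act v (corner R) = act w (corner R) -> act (R:=R) v =1 act w.
Proof.
move=> vw; have [u ru uE] := reduced_ex (rev v ++ w).
have u0 : u = [::].
  apply/eqP; rewrite -(reduced_time ru).2 uE act_cat -vw actK; exact: eqxx.
move=> x; have := uE x; rewrite u0 act_cat /= => e; by rewrite {1}e actKV.
Qed.

End Reduced.

(** * Vertices and cells of the mosaic *)

Section Frame.

Variable R : realType.
Local Notation row := 'rV[R]_5.
Variable h : row -> row.
Hypothesis hP : mosaic_symmetry h.

Let hiso : isometry h := symmetry_iso hP.

Definition origin : row := h (corner R).

Definition place (w : seq gen) : row := h (act w (corner R)).

Definition vertex (x : row) : Prop := exists w, x = place w.

(** An arbitrary choice among the words leading to x; by [act_corner_inj] the value of [root] does
    not depend on it. *)
Definition word (x : row) : seq gen := xget [::] [set w | x = place w].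

Definition root (x : row) (i : gen) : row := h (act (word x) (rt R i)).

Definition step (x : row) (i : gen) : row := x - 2 *: root x i.

(** A negative product means that the wall separates x from the origin, so crossing it leads back:
    these are the incoming directions. *)
Definition descents (x : row) : {set gen} :=
  finset (fun i => form origin (root x i) < 0).

Lemma h_inj : injective h.
Proof. by have [g [_ hK _]] := symmetry_inv hP; apply: can_inj hK. Qed.

Lemma root_place w i : root (place w) i = h (act w (rt R i)).
Proof.
have /h_inj/act_corner_inj e : place (word (place w)) = place w.
  by apply/esym/(@xgetPex _ [::] [set v | place w = place v]); exists w.
by rewrite /root e.
Qed.

Lemma step_place w i : step (place w) i = place (rcons w i).
Proof.
by rewrite /step root_place /place act_rcons_corner (isoB hiso) (isoZ hiso).
Qed.

Lemma descents_place w i : (i \in descents (place w)) = (side R w i < 0).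
Proof. by rewrite inE root_place hiso.2. Qed.

Lemma vertex_reduced x : vertex x -> exists2 w, reduced R w & x = place w.
Proof. by case=> w ->; have [v rv vE] := reduced_ex R w; exists v;
  rewrite // /place vE. Qed.

Lemma vertex_origin : vertex origin.
Proof. by exists [::]. Qed.

Lemma vertex_step x i : vertex x -> vertex (step x i).
Proof. by case=> w ->; rewrite step_place; exists (rcons w i). Qed.

Lemma vertex_ind (P : row -> Prop) : P origin ->
  (forall x i, vertex x -> P x -> i \notin descents x -> P (step x i)) ->
  forall x, vertex x -> P x.
Proof.
move=> P0 PS x /vertex_reduced[w rw ->]; elim: rw => // v i rv Pv si.
rewrite -step_place; apply: PS => //; first by exists v.
by rewrite descents_place -leNgt ltW.
Qed.

Lemma root_step_id x i : vertex x -> root (step x i) i = - root x i.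
Proof.
case=> w ->; rewrite step_place !root_place act_rcons_rt rt_norm.
rewrite (isoB hiso) (isoZ hiso); apply/rowP => j; rewrite !mxE; ring.
Qed.

Lemma root_step_adj x i j : vertex x -> adj i j -> root (step x i) j = root x j.
Proof.
case=> w -> ij; rewrite step_place !root_place act_rcons_rt rt_adj //.
by rewrite mulr0 scale0r subr0.
Qed.

Lemma stepK x i : vertex x -> step (step x i) i = x.
Proof.
move=> vx; rewrite {1}/step root_step_id // /step scalerN opprK subrK //.
Qed.

Lemma stepC x i j : vertex x -> adj i j -> step (step x i) j = step (step x j)
  i.
Proof.
move=> vx ij; rewrite {1}/step root_step_adj // [RHS]/step root_step_adj //.
  by rewrite /step addrAC.
by rewrite adj_sym.
Qed.

Lemma descents_origin : descents origin = finset.set0.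
Proof.
by apply/setP => i; rewrite (descents_place [::]) side_nil finset.in_set0 ltr10.
Qed.

Lemma descents_step x i : vertex x -> i \notin descents x ->
  descents (step x i) = (i |: [set j in descents x | adj i j])%SET.
Proof.
move=> /vertex_reduced[w rw ->]; rewrite descents_place -leNgt le_eqVlt => si.
have {}si : 0 < side R w i.
  by case/orP: si => // /eqP/esym/eqP; rewrite (negPf (reduced_side_neq0 _ rw)).
apply/setP => j; rewrite step_place descents_place side_rcons_lt0 //.
by rewrite !inE root_place hiso.2 andbC.
Qed.

Lemma descents_step_id x i : vertex x ->
  (i \in descents (step x i)) = (i \notin descents x).
Proof.
move=> vx; rewrite !inE root_step_id // formNr oppr_lt0 -leNgt lt_neqAle.
case: vx => w ->; have [v rv E] := reduced_ex R w.
rewrite root_place -E hiso.2 eq_sym.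
by have -> : form (corner R) (act v (rt R i)) != 0 by apply: reduced_side_neq0.
Qed.

Lemma form_root x i j : form (root x i) (root x j) = form (rt R i) (rt R j).
Proof. by rewrite hiso.2 (act_iso R _).2. Qed.

Definition root_sum x (A : {set gen}) : row := \sum_(i in A) root x i.

Definition cell x (K : {set gen}) : set row :=
  [set y | exists2 A : {set gen}, A \subset K & y = x - 2 *: root_sum x A].

Lemma root_sum1 x i : root_sum x [set i]%SET = root x i.
Proof. by rewrite /root_sum big_set1. Qed.

Lemma root_sum0 x : root_sum x finset.set0 = 0.
Proof. by rewrite /root_sum big_set0. Qed.

Lemma root_sumD1 x i (A : {set gen}) : i \in A ->
  root_sum x A = root x i + root_sum x (A :\ i)%SET.
Proof. by move=> iA; rewrite /root_sum (big_setD1 i). Qed.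

(** The walls of a clique are pairwise orthogonal: a step in a direction of K reverses its own root
    and fixes the other roots of K. *)
Lemma corner_of_cell x (K A : {set gen}) :
  vertex x -> clique K -> A \subset K ->
  let y := x - 2 *: root_sum x A in
  vertex y /\ {in K, forall j, root y j = (-1) ^+ (j \in A) *: root x j}.
Proof.
move=> vx cK; elim: {A}#|A| {-2}A (erefl #|A|) => [|n IH] A nA AK /=.
  move/eqP: nA; rewrite cards_eq0 => /eqP->; rewrite root_sum0 scaler0 subr0.
  by split=> // j _; rewrite finset.in_set0 scale1r.
have /card_gt0P[i iA] : (0 < #|A|)%N by rewrite nA.
have [||vy yr] := IH (A :\ i)%SET.
- by move: nA; rewrite (cardsD1 i) iA => -[].
- by apply: fintype.subset_trans AK; apply: subsetDl.
have iK : i \in K by apply: (fintype.subsetP AK).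
have -> : x - 2 *: root_sum x A = step (x - 2 *: root_sum x (A :\ i)%SET) i.
  rewrite /step yr // !inE eqxx scale1r (root_sumD1 _ iA).
  move: (root_sum _ _) (root _ _) => a b.
  by apply/rowP => j; rewrite !mxE; ring.
split=> [|j jK]; first exact: vertex_step.
have [->|ji] := eqVneq j i.
  by rewrite root_step_id // yr // !inE eqxx iA scale1r scaleN1r.
rewrite root_step_adj // ?yr // ?inE ?ji //.
by apply: (cliqueP _ cK) => //; rewrite eq_sym.
Qed.

Lemma cell_vertex x K y : vertex x -> clique K -> cell x K y -> vertex y.
Proof. by move=> vx cK [A AK ->]; have [] := corner_of_cell vx cK AK. Qed.

Lemma cell_refl x K : cell x K x.
Proof. by exists finset.set0; rewrite ?finset.sub0set // root_sum0 scaler0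
  subr0. Qed.

Lemma cellS x (J K : {set gen}) y : J \subset K -> cell x J y -> cell x K y.
Proof. by move=> JK [A AJ ->]; exists A => //;
  apply: fintype.subset_trans JK. Qed.

Lemma cell_step x (K : {set gen}) y i : vertex x -> clique K -> i \in K ->
  cell x K y -> cell x K (step y i).
Proof.
move=> vx cK iK [A AK ->]; have [vy yr] := corner_of_cell vx cK AK.
rewrite /step yr //; case: (boolP (i \in A)) => iA.
  exists (A :\ i)%SET; first by apply: fintype.subset_trans AK; apply: subsetDl.
  rewrite (root_sumD1 _ iA) scaleN1r; move: (root_sum _ _) (root _ _) => a b.
  by apply/rowP => j; rewrite !mxE; ring.
exists (i |: A)%SET; first by apply/fintype.subsetP => j;
  rewrite !inE => /orP[/eqP->//|/(fintype.subsetP AK)].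
rewrite scale1r (@root_sumD1 _ i (i |: A)%SET) ?inE ?eqxx // finset.setU1K //.
move: (root_sum _ _) (root _ _) => a b.
by apply/rowP => j; rewrite !mxE; ring.
Qed.

Lemma cell_ind x (K : {set gen}) (P : row -> Prop) :
  vertex x -> clique K -> P x ->
  (forall y i, vertex y -> cell x K y -> i \in K -> P y -> P (step y i)) ->
  forall y, cell x K y -> P y.
Proof.
move=> vx cK Px PS y [A AK ->] {y}.
elim: {A}#|A| {-2}A (erefl #|A|) AK => [|n IH] A nA AK.
  by move/eqP: nA; rewrite cards_eq0 => /eqP->; rewrite root_sum0 scaler0 subr0.
have /card_gt0P[i iA] : (0 < #|A|)%N by rewrite nA.
have AK' : (A :\ i)%SET \subset K by apply: fintype.subset_trans AK;
  apply: subsetDl.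
have iK : i \in K by apply: (fintype.subsetP AK).
have [vy yr] := corner_of_cell vx cK AK'.
have -> : x - 2 *: root_sum x A = step (x - 2 *: root_sum x (A :\ i)%SET) i.
  rewrite /step yr // !inE eqxx scale1r (root_sumD1 _ iA).
  move: (root_sum _ _) (root _ _) => a b.
  by apply/rowP => j; rewrite !mxE; ring.
apply: PS => //; first by exists (A :\ i)%SET.
by apply: IH => //; move: nA; rewrite (cardsD1 i) iA => -[].
Qed.

(** Cells correspond to cosets of the subgroup generated by K, so the same K labels a cell at each
    of its corners. *)
Lemma cell_eq x (K : {set gen}) y : vertex x -> clique K ->
  cell x K y -> cell y K = cell x K.
Proof.
have sub z t : vertex z -> clique K -> cell z K t -> cell t K `<=` cell z K.
  move=> vz cK tz; have vt := cell_vertex vz cK tz => s.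
  by move: s; apply: cell_ind => // s i vs ts iK; apply: cell_step.
move=> vx cK xy; have vy := cell_vertex vx cK xy.
apply/seteqP; split; first exact: sub.
apply: sub => //; case: xy => A AK ->; have [_ yr] := corner_of_cell vx cK AK.
exists A => //; set z := x - _.
have -> : root_sum z A = - root_sum x A.
  rewrite /root_sum -sumrN; apply: eq_bigr => i iA.
  by rewrite yr ?(fintype.subsetP AK) // iA scaleN1r.
by rewrite /z scalerN opprK subrK.
Qed.

(** Pair both sums with the root of some j in A but not in B: the sum over A gives 1, its roots
    being orthonormal, and the sum over B has only nonpositive terms. *)
Lemma corner_inj x (A B : {set gen}) : clique A ->
  x - 2 *: root_sum x A = x - 2 *: root_sum x B -> A \subset B.
Proof.
move=> /cliqueP cA /addrI/oppr_inj e2.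
have {e2} e : root_sum x A = root_sum x B.
  by apply: scalerI e2; rewrite pnatr_eq0.
apply/fintype.subsetP => j jA; apply/negPn/negP => jB.
have : form (root x j) (root_sum x A) = 1.
  rewrite (root_sumD1 _ jA) formDr form_root rt_norm form_sumr big1 ?addr0 //
    => i.
  rewrite !inE eq_sym => /andP[ji iA]; rewrite form_root rt_adj //.
  exact: cA.
rewrite e form_sumr => s1.
suff : 1 <= 0 :> R by rewrite ler10.
rewrite -s1; apply: sumr_le0 => i iB; rewrite form_root rt_le0 //.
by apply: contraNneq jB => ->.
Qed.

Lemma cellI x (K1 K2 : {set gen}) : clique K1 -> clique K2 ->
  cell x K1 `&` cell x K2 = cell x (K1 :&: K2)%SET.
Proof.
move=> c1 c2; apply/seteqP; split=> [y [[A AK ->] [B BK e]]|y [A]].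
  exists A => //; rewrite finset.subsetI AK /=.
  apply: fintype.subset_trans BK; apply: corner_inj e.
  exact: sub_clique c1.
by rewrite finset.subsetI => /andP[A1 A2] ->; split; exists A.
Qed.

Lemma step_cell x (K : {set gen}) i : cell x K (step x i) -> i \in K.
Proof.
case=> A AK; rewrite /step -(root_sum1 x i) => /corner_inj iA.
apply: (fintype.subsetP AK); rewrite -finset.sub1set; apply: iA.
by apply/cliqueP => j k; rewrite !inE => /eqP-> /eqP->; rewrite eqxx.
Qed.

Lemma step_in_cell x (K : {set gen}) i : i \in K -> cell x K (step x i).
Proof. by move=> iK; exists [set i]%SET;
  rewrite ?finset.sub1set // root_sum1. Qed.

Lemma cell_subP x (J K : {set gen}) : cell x J `<=` cell x K <-> J \subset K.
Proof.
split=> [s|JK y]; last exact: cellS.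
by apply/fintype.subsetP => i /step_in_cell-/(_ x)/s/step_cell.
Qed.

Lemma step_inj x i j : step x i = step x j -> i = j.
Proof.
move=> e; apply/set1P; apply: (@step_cell x).
by rewrite e; apply: step_in_cell; rewrite inE.
Qed.

Lemma step_neq x i : step x i <> x.
Proof.
move=> e; have : cell x finset.set0 (step x i) by rewrite e; apply: cell_refl.
by move/step_cell; rewrite inE.
Qed.

Lemma base_cell_image w u k : {subset u <= iota 1 4} -> (k <= 4)%N ->
  (h \o (act w \o simple_act (R:=R) u)) @` base_cell k =
  cell (place w) (wact u @: std 0 k).
Proof.
move=> uP k4; have winj := wact_inj uP;
  have siso := symmetry_iso (simple_act_symmetry R uP).
have aiso := act_iso R w.
have E (A : {set gen}) : (h \o (act w \o simple_act (R:=R) u)) (corner R - 2 *: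
  rt_sum R A) =
    place w - 2 *: root_sum (place w) (wact u @: A).
  rewrite /= (isoB siso) (isoZ siso) simple_act_corner // (isoB aiso) (isoZ
    aiso).
  rewrite (isoB hiso) (isoZ hiso); congr (_ - _ *: _).
  rewrite /rt_sum (iso_sum siso) (iso_sum aiso) (iso_sum hiso).
  rewrite /root_sum big_imset /=; last by move=> ? ? _ _; apply: winj.
  by apply: eq_bigr => i _; rewrite root_place simple_act_rt.
apply/seteqP; split=> [y [x /(base_cellE _ k4)[A Ak ->] <-]|y [B Bk ->]].
  by rewrite E; exists (wact u @: A) => //; apply: imsetS.
have BE : B = wact u @: (wact u @^-1: B).
  apply/setP => i; apply/idP/imsetP => [iB|[j]]; last by rewrite inE => ? ->.
  have /imsetP[j _ e] := fintype.subsetP Bk _ iB.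
  by exists j => //; rewrite inE -e.
exists (corner R - 2 *: rt_sum R (wact u @^-1: B)); last by rewrite E -BE.
apply/base_cellE => //; exists (wact u @^-1: B) => //.
by apply/fintype.subsetP => i; rewrite inE => /(fintype.subsetP Bk);
  rewrite mem_imset.
Qed.

(** In [symmetry_factor] the word selects the vertex x and the stabilizer turns the standard
    k-clique into K; conversely, flag transitivity realises every K. *)
Lemma mosaic_cellP k (c : set row) : (k <= 4)%N -> mosaic_cell k c <->
  exists x (K : {set gen}), [/\ vertex x, clique K, #|K| = k & c = cell x K].
Proof.
move=> k4; split=> [[g gP ->]|[x [K [[w ->] cK Kk ->]]]].
  have [h' [h'P hK h'K]] := symmetry_inv hP.
  have [w [u [uP E]]] := symmetry_factor (symmetry_comp h'P gP).
  have -> : g = h \o (act w \o simple_act (R:=R) u).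
    by rewrite -E; apply/funext => x /=; rewrite h'K.
  exists (place w), (wact u @: std 0 k); split; first by exists w.
  - by rewrite clique_wact ?std4_clique.
  - rewrite card_imset ?card_std //; first exact: leq_trans k4 _.
    exact: wact_inj.
  - exact: base_cell_image.
have [||_ [u uP [KE _]]] := @clique_orbit K finset.set0;
  rewrite ?finset.setU0 //.
  by rewrite -setI_eq0 finset.setI0.
exists (h \o (act w \o simple_act (R:=R) u));
  last by rewrite base_cell_image // -Kk -KE.
apply: symmetry_comp => //; apply: symmetry_comp; first exact: act_symmetry.
exact: simple_act_symmetry.
Qed.

End Frame.

(** * Ascending paths *)

Local Open Scope nat_scope.

Section States.

Variable R : realType.
Local Notation row := 'rV[R]_5.
Variable h : row -> row.
Hypothesis hP : mosaic_symmetry h.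

Local Notation V0 := (origin h).
Local Notation vertex := (vertex h).
Local Notation step := (step h).
Local Notation descents := (descents h).
Local Notation cell := (cell h).

(* For S0 = set0 the states are the vertices of the mosaic with their distance
   from V0; for S0 the directions of the first hypercube they are those of P,
   and S collects the directions of S0 not yet used. *)
Inductive state (S0 : {set gen}) : nat -> row -> {set gen} -> Prop :=
| state0 : state S0 0 V0 S0
| stateS n x S i : state S0 n x S -> i \notin descents x ->
    i \in S :|: link S -> state S0 n.+1 (step x i) (S :\ i)%SET.

Lemma state_vertex S0 n x S : state S0 n x S -> vertex x.
Proof.
by elim=> [|m y T i _ vy _ _]; [exact: vertex_origin|exact: (vertex_step hP)].
Qed.

Lemma descents_step_up x i j : vertex x -> i \in descents x ->
  adj i j -> j \notin descents x -> j \notin descents (step x i).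
Proof.
move=> vx ix ij; apply: contra => jx.
have -> : descents x = descents (step (step x i) i) by rewrite (stepK hP).
rewrite (descents_step hP); first by rewrite in_setU1 finset.in_set jx ij orbT.
  exact: (vertex_step hP).
by rewrite (descents_step_id hP) // negbK.
Qed.

(** If i is not the last step q, it is already incoming at the predecessor and adjacent to q; the
    two steps commute, so i can be made the last one. Hence the level and S depend on x alone, see
    [state_uniq]. *)
Lemma state_down S0 n x S i : state S0 n x S -> i \in descents x ->
  exists m S', [/\ n = m.+1, state S0 m (step x i) S', S = (S' :\ i)%SET &
                   i \in S' :|: link S'].
Proof.
move=> st; elim: st i => [i|{n x}n z {}S q st IH qz qS i].
  by rewrite (descents_origin hP) inE.
have vz := state_vertex st.
rewrite (descents_step hP) // in_setU1 => /orP[/eqP->|].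
  by exists n, S; rewrite (stepK hP).
rewrite finset.in_set => /andP[iz qi].
have [m [S' [-> st' SE iS']]] := IH i iz.
have iq : adj i q by rewrite adj_sym.
exists m.+1, (S' :\ q)%SET; split=> //.
- rewrite (stepC hP) //; apply: stateS => //.
    exact: descents_step_up.
  move: qS; rewrite SE !inE => /orP[/andP[_ ->]//|/forall_inP qS]; apply/orP.
  right; apply/forall_inP => j jS'; have [->//|ji] := eqVneq j i.
  by apply: qS; rewrite !inE ji.
- by rewrite SE; apply/setP => j; rewrite !inE andbCA.
move: iS'; rewrite !finset.in_setU =>
  /orP[iS'|/(fintype.subsetP (linkS (subsetDl S' [set q]%SET)))->];
    last by rewrite orbT.
by rewrite !inE iS' andbT; case: eqP qi => // ->; rewrite adj_irr.
Qed.

Lemma state_origin S0 n S : state S0 n V0 S -> n = 0 /\ S = S0.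
Proof.
move E : V0 => x st; case: st E => // {n}m y T i st iy _ E.
have : i \in descents (step y i).
  by rewrite (descents_step_id hP) //; apply: state_vertex st.
by rewrite -E (descents_origin hP) inE.
Qed.

Lemma state_uniq S0 n x S n' S' : state S0 n x S -> state S0 n' x S' ->
  n = n' /\ S = S'.
Proof.
move=> st; elim: st n' S' => [n' S' /state_origin[-> ->]//|].
move=> {n x S}n z S q st IH qz qS n' S' st'.
have vz := state_vertex st.
have qd : q \in descents (step z q) by rewrite (descents_step_id hP).
have [m [S'' [-> st'' -> _]]] := state_down st' qd.
by move: st''; rewrite (stepK hP) // => /IH[-> ->].
Qed.

Lemma state_sub S0 n x S : state S0 n x S -> S \subset S0.
Proof.
elim=> // m y T i _ TS0 _ _; apply: fintype.subset_trans TS0; exact: subsetDl.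
Qed.

Lemma vertex_state x : vertex x -> exists n, state finset.set0 n x finset.set0.
Proof.
move: x; apply: (vertex_ind hP); first by exists 0; exact: state0.
move=> y i vy [n st] iy; exists n.+1; have := stateS st iy;
  rewrite finset.set0D; apply.
by rewrite link0 finset.setUT finset.in_setT.
Qed.

Lemma clique_descents x : vertex x -> clique (descents x).
Proof.
move: x; apply: (vertex_ind hP).
  by rewrite (descents_origin hP); apply/cliqueP => i j; rewrite inE.
move=> y i vy cy iy; rewrite (descents_step hP) //; apply: cliqueU1.
  by apply: sub_clique cy; apply/fintype.subsetP => j; rewrite inE => /andP[].
by apply/linkP => j; rewrite inE => /andP[].
Qed.

Lemma state_succ S0 n x S : state S0 n.+1 x S -> exists i, i \in descents x.
Proof.
move E : n.+1 => m st; case: st E => // {}m y T i st iy _ _.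
by exists i; rewrite (descents_step_id hP) //; apply: state_vertex st.
Qed.

Section Pyramid.

Variable S0 : {set gen}.
Hypothesis cS0 : clique S0.

Definition reached (x : row) : Prop := exists n S, state S0 n x S.

Lemma state_clique n x S : state S0 n x S -> clique S.
Proof. by move/state_sub/sub_clique; apply. Qed.

Lemma descents_link n x S : state S0 n x S -> descents x \subset link S.
Proof.
move=> st; apply/fintype.subsetP => i /(state_down st)[m [S' [_ st' -> ]]].
rewrite finset.in_setU => /orP[iS'|].
  by apply: clique_link => //; apply: state_clique st'.
by apply/fintype.subsetP/linkS/subsetDl.
Qed.

Lemma reached_step n x S i : state S0 n x S ->
  reached (step x i) <-> i \in S :|: link S.
Proof.
move=> st; have vx := state_vertex st; split=> [[m [S' st']]|iS].
  have [ix|ix] := boolP (i \in descents x).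
    by rewrite finset.in_setU (fintype.subsetP (descents_link st)) ?orbT.
  have [|m' [S'' [_ st'' _ iS'']]] := state_down st' (i := i).
    by rewrite (descents_step_id hP).
  by move: st''; rewrite (stepK hP) // => /(state_uniq st)[_ ->].
have [/(state_down st)[m [S' [_ st' _ _]]]|ix] := boolP (i \in descents x).
  by exists m, S'.
by exists n.+1, (S :\ i)%SET; apply: stateS.
Qed.

Lemma reached_cell n x S (K : {set gen}) : state S0 n x S -> clique K ->
  S \subset K -> forall y, cell x K y ->
  exists m S', state S0 m y S' /\ S' \subset K.
Proof.
move=> st cK SK; have vx := state_vertex st.
apply: (cell_ind hP) => //; first by exists n, S.
move=> y i vy _ iK [m [S' [st' S'K]]].
have [/(state_down st')[m' [S'' [_ st'' S'E _]]]|iy] := boolP (i \in descents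
  y).
  exists m', S''; split=> //; apply/fintype.subsetP => j jS.
  have [->//|ji] := eqVneq j i; apply: (fintype.subsetP S'K).
  by rewrite S'E !inE ji.
exists m.+1, (S' :\ i)%SET; split; last first.
  by apply: fintype.subset_trans S'K; apply: subsetDl.
apply: stateS => //; rewrite finset.in_setU; apply/orP.
have [|iS'] := boolP (i \in S'); [by left|right]; apply/linkP => j jS'.
apply: (cliqueP _ cK) => //; first exact: (fintype.subsetP S'K).
by apply: contraNneq iS' => ->.
Qed.

(** Each direction of K lies in S or its link, so a t in S outside K would be adjacent to the whole
    tetrahedron K, which is impossible. *)
Lemma cell_reached n x S (K : {set gen}) : state S0 n x S -> tetra K ->
  (forall y, cell x K y -> reached y) -> S \subset K.
Proof.
move=> st tK cP; apply/fintype.subsetP => t tS; apply/negPn/negP => tK'.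
have /negP[] := tetra_max t tK.
apply/linkP => i iK; have : i \in S :|: link S.
  by apply/(reached_step _ st)/cP/step_in_cell.
have it : i != t by apply: contraNneq tK' => <-.
rewrite finset.in_setU adj_sym => /orP[iS|/linkP]; last exact.
by apply: (cliqueP _ (state_clique st)).
Qed.

End Pyramid.

Lemma tetra_top x (K : {set gen}) :
  vertex x -> tetra K -> K \subset descents x ->
  descents x = K.
Proof.
move=> vx tK Kx; apply/eqP; rewrite finset.eqEsubset Kx andbT.
apply/fintype.subsetP => j jx; apply/negPn/negP => jK.
have /negP[] := tetra_max j tK.
apply/linkP => i iK; apply: (cliqueP _ (clique_descents vx)) => //.
  exact: (fintype.subsetP Kx).
by apply: contraNneq jK => ->.
Qed.

Lemma top_uniq x (K : {set gen}) y : vertex x -> clique K ->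
  cell x K y -> K \subset descents x -> K \subset descents y -> y = x.
Proof.
move=> vx cK [A AK ->] Kx; have [_ yr] := corner_of_cell hP vx cK AK.
move=> /fintype.subsetP Ky; have [->|[i iA]] := set_0Vmem A.
  by rewrite root_sum0 scaler0 subr0.
have iK := fintype.subsetP AK _ iA.
have := Ky _ iK; have := fintype.subsetP Kx _ iK.
by rewrite !inE yr // iA scaleN1r formNr oppr_lt0 => /lt_trans h1 /h1;
  rewrite ltxx.
Qed.

(** The ascent uses only directions of K that are not incoming at x, so the top also lies in every
    other cell at x containing these; [reached_pascal] relies on this. *)
Lemma top_ex x (K : {set gen}) : vertex x -> clique K ->
  exists t, cell x (K :\: descents x)%SET t /\ K \subset descents t.
Proof.
move=> vx cK; set J := (K :\: descents x)%SET.
have cJ : clique J by apply: sub_clique cK; apply: subsetDl.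
have up n y : #|K :\: descents y| <= n -> cell x J y ->
    (K :&: descents x)%SET \subset descents y ->
    exists t, cell x J t /\ K \subset descents t.
  elim: n y => [|n IH] y.
    rewrite leqn0 cards_eq0 finset.setD_eq0 => Ky xy _; by exists y.
  move=> nK xy sub; have [Ky|/subsetPn[i iK iy]] := boolP (K \subset descents
    y).
    by exists y.
  have vy := cell_vertex hP vx cJ xy.
  have Dy := descents_step hP vy iy.
  have keep j : j \in K -> j \in descents y -> j \in descents (step y i).
    move=> jK jy; rewrite Dy in_setU1 finset.in_set jy /=.
    by have [//|ji] := eqVneq j i; rewrite (cliqueP _ cK) // eq_sym.
  apply: (IH (step y i)).
  - rewrite -ltnS; apply: leq_trans nK; apply: proper_card.
    apply/properP; split.
      apply/fintype.subsetP => j; rewrite !finset.in_setD => /andP[jn jK].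
      by rewrite jK andbT; apply: contra jn; apply: keep.
    exists i; rewrite finset.in_setD iK ?iy // Dy in_setU1 eqxx //.
  - apply: (cell_step hP) => //; rewrite finset.in_setD iK andbT.
    apply: contra iy => ix; apply: (fintype.subsetP sub).
    by rewrite finset.in_setI iK.
  apply/fintype.subsetP => j jKx; apply: keep;
    last exact: (fintype.subsetP sub).
  by move: jKx; rewrite finset.in_setI => /andP[].
apply: (up _ x (leqnn _)); first exact: cell_refl.
exact: finset.subsetIr.
Qed.

End States.

(** * Shortest paths and values *)

Lemma card_seq (T : choiceType) (A : set T) (s : seq T) :
  uniq s -> (forall x, A x <-> x \in s) -> card A = size s.
Proof.
move=> us As; have -> : A = [set` s] by apply/seteqP; split=> x /=; move/As.
rewrite /card -[in RHS](undup_id us) -card_fseq; congr (#|` _|%fset).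
apply/fsetP => x; rewrite in_fset_set; last exact: finite_seq.
by rewrite inE; apply/idP/idP; rewrite inE.
Qed.

Lemma card_set_of (T : choiceType) (I : finType) (A : set T) (B : {set I})
  (f : I -> T) : injective f ->
  (forall x, A x <-> exists2 i, i \in B & x = f i) -> card A = #|B|.
Proof.
move=> fi AB; rewrite (@card_seq _ _ [seq f i | i <- enum B]) ?size_map -?cardE
  //.
  by rewrite map_inj_uniq ?enum_uniq.
move=> x; rewrite AB; split=> [[i iB ->]|/mapP[i]].
  by rewrite map_f // mem_enum.
by rewrite mem_enum => iB ->; exists i.
Qed.

Section Geodesics.

Variable R : realType.
Local Notation row := 'rV[R]_5.
Variable h : row -> row.
Hypothesis hP : mosaic_symmetry h.

Local Notation V0 := (origin h).
Local Notation vertex := (vertex h).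
Local Notation step := (step h).
Local Notation descents := (descents h).
Local Notation cell := (cell h).
Local Notation state := (state h).

(** Paths are listed by their last edge, which enters x along an incoming direction. One list serves
    both the mosaic and P, since [descents] is the same for both. *)
Fixpoint geodesics (n : nat) (x : row) : seq (seq row) :=
  if n is m.+1 then
    [seq rcons q x | i <- enum (descents x), q <- geodesics m (step x i)]
  else [:: [::]].

Lemma size_geodesics n x : size (geodesics n.+1 x) =
  \sum_(i in descents x) size (geodesics n (step x i)).
Proof.
rewrite /= size_allpairs_dep sumnE big_map big_enum_cond /=.
by apply: eq_bigl => i; rewrite andbT.
Qed.

Section Relation.

Variables (S0 : {set gen}) (e : rel row).
Hypothesis eP : forall x n S, state S0 n x S -> forall y,
  e x y <-> exists2 i, i \in S :|: link S & y = step x i.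

Lemma path_state p n x S : state S0 n x S -> path e x p ->
  exists m S', state S0 m (last x p) S' /\ m <= n + size p.
Proof.
elim: p n x S => [|y p IH] n x S st /=; first by exists n, S; rewrite addn0.
case/andP => /(eP st)[i iS ->] /IH {IH}IH.
have [ix|ix] := boolP (i \in descents x).
  have [m [S' [nm st' _ _]]] := state_down hP st ix.
  have [m' [S'' [st'' le]]] := IH _ _ st'; exists m', S''; split=> //.
  by apply: leq_trans le _; rewrite nm leq_add.
have [m' [S'' [st'' le]]] := IH _ _ (stateS st ix iS); exists m', S'';
  split=> //.
by rewrite addnS -addSn.
Qed.

Lemma state_walk n x S : state S0 n x S ->
  exists2 p, walk e V0 x p & size p = n.
Proof.
elim=> [|m y T i st [p /andP[pp /eqP lp] sp] iy iT].
  by exists [::] => //; rewrite /walk /= eqxx.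
exists (rcons p (step y i)); last by rewrite size_rcons sp.
rewrite /walk rcons_path last_rcons eqxx pp andbT lp; apply/(eP st);
  by exists i.
Qed.

Lemma walk_size n x S p : state S0 n x S -> walk e V0 x p -> n <= size p.
Proof.
move=> st /andP[pp /eqP lp].
have [m [S' [st' le]]] := path_state (state0 h S0) pp.
by move: st'; rewrite lp => /(state_uniq hP st)[-> _].
Qed.

Lemma shortest_pathsP n x S p : state S0 n x S ->
  shortest_paths e V0 x p <-> walk e V0 x p && (size p == n).
Proof.
move=> st; have [q qw qn] := state_walk st; split=> [[pw ps]|/andP[pw /eqP pn]].
  by rewrite pw eqn_leq (walk_size st pw) -qn ps.
by split=> // r rw; rewrite pn (walk_size st rw).
Qed.

Lemma geodesicsP n x S p : state S0 n x S ->
  (p \in geodesics n x) = walk e V0 x p && (size p == n).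
Proof.
elim: n x S p => [|n IH] x S p st.
  rewrite inE; case: p => [|y p]; last by rewrite andbF.
  have -> : x = V0.
    have h0 k y T : state S0 k y T -> k = 0 -> y = V0 by case.
    exact: h0 st (erefl _).
  by rewrite /walk /= !eqxx.
have vx := state_vertex hP st.
apply/allpairsPdep/andP => [[i [q []]]|[]].
  rewrite mem_enum => ix; have [m [S' [[<-] st' SE iS']]] := state_down hP st
    ix.
  rewrite (IH _ _ _ st') => /andP[/andP[qp /eqP ql] /eqP qn] ->.
  rewrite size_rcons qn; split=> //.
  rewrite /walk rcons_path last_rcons eqxx qp andbT ql; apply/(eP st').
  by exists i; rewrite ?(stepK hP).
elim/last_ind: p => // q z _; rewrite /walk rcons_path last_rcons size_rcons.
case/andP => /andP[qp qz] /eqP zx; subst z => /eqP[qn].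
have [m [S' [st' mn]]] := path_state (state0 h S0) qp.
have vy := state_vertex hP st'.
have [i iS' xE] := (eP st' _).1 qz.
(* Otherwise x, on level n + 1, would lie just below a vertex that q reaches in n steps. *)
have iy : i \notin descents (last V0 q).
  apply/negP => iy; have [m' [S'' [mE st'' _ _]]] := state_down hP st' iy.
  rewrite -xE in st''; have [nm _] := state_uniq hP st st''.
  by move: mn; rewrite mE -nm add0n qn ltnNge leqnSn.
have ix : i \in descents x by rewrite xE (descents_step_id hP).
have xiE : step x i = last V0 q by rewrite xE (stepK hP).
exists i, q; split; rewrite ?mem_enum //.
have [m' [S'' [[mE] st'' _ _]]] := state_down hP st ix.
rewrite -mE in st''.
by rewrite (IH _ _ _ st'') /walk qp xiE eqxx qn eqxx.
Qed.

Lemma geodesics_uniq n x S : state S0 n x S -> uniq (geodesics n x).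
Proof.
elim: n x S => [//|n IH] x S st /=.
have vx := state_vertex hP st.
have dn i : i \in enum (descents x) -> exists S', state S0 n (step x i) S'.
  rewrite mem_enum => /(state_down hP st)[m [S' [[->] st' _ _]]]; by exists S'.
apply: allpairs_uniq_dep; first exact: enum_uniq.
  by move=> i /dn[S' /IH].
move=> _ _ /allpairsPdep[i [p [id pg ->]]] /allpairsPdep[j [q [jd qg ->]]] /=.
move=> /rcons_inj[pq]; subst q.
have [Si sti] := dn _ id; have [Sj stj] := dn _ jd.
move: pg qg; rewrite (geodesicsP _ sti) (geodesicsP _ stj).
move=> /andP[/andP[_ /eqP li] _] /andP[/andP[_ /eqP lj] _].
by have /(step_inj hP)-> : step x i = step x j by rewrite -li -lj.
Qed.

Lemma card_shortest n x S : state S0 n x S ->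
  card (shortest_paths e V0 x) = size (geodesics n x).
Proof.
move=> st; apply: (@card_seq _ _ (geodesics n x)).
  exact: geodesics_uniq st.
by move=> p; rewrite (geodesicsP p st); exact: (shortest_pathsP p st).
Qed.

End Relation.

Lemma mosaic_edgeP x y :
  mosaic_edge x y <-> vertex x /\ exists i, y = step x i.
Proof.
have c1 (i : gen) : clique [set i]%SET.
  by apply/cliqueP => j k; rewrite !inE => /eqP-> /eqP->; rewrite eqxx.
have cE z (i : gen) : vertex z -> cell z [set i]%SET = [set z; step z i].
  move=> vz; apply/seteqP; split=> t; last first.
    by case=> ->; [apply: cell_refl|apply: step_in_cell; rewrite inE].
  apply: (cell_ind hP) => //; first by left.
  by move=> s j vs _; rewrite inE => /eqP-> [->|->]; [right|left;
    rewrite (stepK hP)].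
split=> [/asboolP[xy /(mosaic_cellP hP _ (isT :
  1 <= 4))[z [K [vz cK /eqP/cards1P[i Ki] E]]]]|[vx [i ->]]].
  rewrite Ki cE // in E.
  have xz : [set z; step z i] x by rewrite -E; left.
  have yz : [set z; step z i] y by rewrite -E; right.
  have vs := vertex_step hP i vz.
  case: xz yz xy => -> [] -> xy; try by case: xy.
    by split=> //; exists i.
  by split=> //; exists i; rewrite (stepK hP).
apply/asboolP; split; first by move/esym; exact: (step_neq hP).
apply/(mosaic_cellP hP) => //; exists x, [set i]%SET.
by rewrite cards1 cE.
Qed.

Lemma mosaic_edge_state x n S : state finset.set0 n x S -> forall y,
  mosaic_edge x y <-> exists2 i, i \in S :|: link S & y = step x i.
Proof.
move=> st y; have vx := state_vertex hP st.
have -> : S = finset.set0.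
  by apply/eqP; rewrite -finset.subset0; apply: state_sub st.
rewrite finset.set0U link0 mosaic_edgeP; split=> [[_ [i ->]]|[i _ ->]].
  by exists i.
by split=> //; exists i.
Qed.

Lemma value_geodesics n x S : state finset.set0 n x S ->
  value V0 x = size (geodesics n x).
Proof. exact: (card_shortest mosaic_edge_state). Qed.

Lemma value_gt0 x : vertex x -> 0 < value V0 x.
Proof.
move=> /(vertex_state hP)[n st]; rewrite (value_geodesics st).
have [p pw pn] := state_walk mosaic_edge_state st.
have := geodesicsP mosaic_edge_state p st; rewrite pw pn eqxx /=.
by case: geodesics.
Qed.

Lemma value_origin : value V0 V0 = 1.
Proof. by rewrite (value_geodesics (state0 h _)). Qed.

Lemma value_descents x i : vertex x -> i \in descents x ->
  value V0 x = \sum_(j in descents x) value V0 (step x j).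
Proof.
move=> /(vertex_state hP)[n st] ix.
have [m [_ [nm _ _ _]]] := state_down hP st ix; subst n.
rewrite (value_geodesics st) size_geodesics; apply: eq_bigr => j jx.
by have [_ [S' [[<-] st' _ _]]] := state_down hP st jx;
  rewrite (value_geodesics st').
Qed.

(** The value of the new vertex is a sum of positive terms over its incoming edges, one of which
    comes from x; equality means that there is no other. *)
Lemma value_step x i : vertex x -> i \notin descents x ->
  value V0 x <= value V0 (step x i) ?= iff (descents (step x i) == [set i]%SET).
Proof.
move=> vx ix; have vs := vertex_step hP i vx.
have is_ : i \in descents (step x i) by rewrite (descents_step_id hP).
rewrite (value_descents vs is_) (bigD1 i) //= (stepK hP) //.
have [->|D] := eqVneq (descents (step x i)) [set i]%SET.
  by rewrite big1 ?addn0 => [|j /andP[]];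
    [exact/leqif_refl|rewrite inE => /eqP->; rewrite eqxx].
split; first exact: leq_addr.
rewrite -{1}[value _ _]addn0 eqn_add2l eq_sym; apply/negbTE.
have [j js ji] : exists2 j, j \in descents (step x i) & j != i.
  apply/exists_inP; apply: contraR D; rewrite negb_exists_in => /forall_inP h'.
  rewrite finset.eqEsubset finset.sub1set is_ andbT;
    apply/fintype.subsetP => j /h'.
  by rewrite negbK inE.
rewrite -lt0n (bigD1 j) ?js //=; apply: leq_trans (leq_addr _ _).
exact/value_gt0/vertex_step.
Qed.

End Geodesics.

(** * The hypercubes of P *)

Section Pascal.

Variable R : realType.
Local Notation row := 'rV[R]_5.
Variable h : row -> row.
Hypothesis hP : mosaic_symmetry h.

Local Notation V0 := (origin h).
Local Notation vertex := (vertex h).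
Local Notation step := (step h).
Local Notation descents := (descents h).
Local Notation cell := (cell h).
Local Notation T0 := (std 0 4).
Local Notation Q0 := (cell V0 T0).
Local Notation state := (state h T0).
Local Notation reached := (reached h T0).
Local Notation pascal := (pascal V0 Q0).

Let cT0 : clique T0.
Proof. by have /andP[] := std4_tetra. Qed.

(** Ascending within the cell never lowers the value, and the step into the top raises it strictly,
    because all four directions of K are incoming there. *)
Lemma value_top x (K : {set gen}) y : vertex x -> tetra K -> cell x K y ->
  ~~ (K \subset descents y) ->
  exists t, [/\ cell x K t, K \subset descents t & value V0 y < value V0 t].
Proof.
move=> vx /andP[cK /eqP K4].
have [n] := ubnP #|(K :\: descents y)%SET|.
elim: n y => // n IH y nK xy Ky.
have vy := cell_vertex hP vx cK xy.
have /subsetPn[i iK iy] := Ky.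
have xs := cell_step hP vx cK iK xy; have vs := vertex_step hP i vy.
have Dy := descents_step hP vy iy.
have keep j : j \in K -> j \in descents y -> j \in descents (step y i).
  move=> jK jy; rewrite Dy in_setU1 finset.in_set jy /=.
  by have [//|ji] := eqVneq j i; rewrite (cliqueP _ cK) // eq_sym.
have le := value_step hP vy iy.
have [Ks|Ks] := boolP (K \subset descents (step y i)).
  exists (step y i); split=> //; rewrite (ltn_leqif le).
  apply/eqP => E; have := subset_leq_card Ks.
  by rewrite E cards1 K4.
have [|t [xt Kt lt]] := IH _ _ xs Ks.
  rewrite -ltnS; apply: leq_trans nK; rewrite ltnS; apply: proper_card.
  apply/properP; split.
    apply/fintype.subsetP => j; rewrite !finset.in_setD => /andP[jn jK].
    by rewrite jK andbT; apply: contra jn; apply: keep.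
  by exists i; rewrite finset.in_setD iK ?iy // Dy in_setU1 eqxx.
by exists t; split; [exact: xt|exact: Kt|exact: leq_ltn_trans le.1 lt].
Qed.

Lemma largest_top x (K : {set gen}) t : vertex x -> tetra K ->
  largest_value_vertex V0 (cell x K) t <-> cell x K t /\ K \subset descents t.
Proof.
move=> vx tK; have /andP[cK _] := tK.
split=> [[xt max]|[xt Kt]]; (split; first exact: xt); last move=> y xy.
  apply/negPn/negP => /(value_top vx tK xt)[y [/max le _]].
  by rewrite ltnNge le.
have [Ky|/(value_top vx tK xy)[t' [xt' Kt' lt]]] := boolP (K \subset descents
  y).
  suff -> : y = t by exact: leqnn.
  by apply: (top_uniq hP (cell_vertex hP vx cK xt) cK _ Kt Ky);
    rewrite (cell_eq hP vx cK xt).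
suff <- : t' = t by exact: ltnW lt.
by apply: (top_uniq hP (cell_vertex hP vx cK xt) cK _ Kt Kt');
  rewrite (cell_eq hP vx cK xt).
Qed.

Lemma mosaic_cell_at k (c : set row) x : k <= 4 -> mosaic_cell k c -> c x ->
  exists K : {set gen}, [/\ vertex x, clique K, #|K| = k & c = cell x K].
Proof.
move=> k4 /(mosaic_cellP hP _ k4)[z [K [vz cK Kk ->]]] zx.
exists K; split=> //; first exact: (cell_vertex hP vz cK).
by rewrite (cell_eq hP vz cK zx).
Qed.

Lemma mosaic_cell_cell k x (K : {set gen}) : k <= 4 -> vertex x -> clique K ->
  #|K| = k -> mosaic_cell k (cell x K).
Proof. by move=> k4 vx cK Kk; apply/(mosaic_cellP hP) => //; exists x, K. Qed.

Lemma reached_cube n x S (K : {set gen}) : state n x S -> clique K ->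
  S \subset K -> cell x K `<=` reached.
Proof.
move=> st cK SK y /(reached_cell hP st cK SK)[m [S' [st' _]]].
by exists m, S'.
Qed.

(** At a top vertex the incoming directions form a tetrahedron; S is adjacent to all of it, hence
    empty, and every hypercube there is allowed. In the convexity rule S lies in both tetrahedra,
    hence in their intersection and in the new one. *)
Lemma pascal_reached Q : pascal Q -> mosaic_cell 4 Q /\ Q `<=` reached.
Proof.
elim=> [|{}Q x Q' _ [mQ Qr] xQ mQ' Q'x|Q1 Q2 {}Q _ [m1 r1] _ [m2 r2] m12 mQ
  sub].
- split; first by apply: mosaic_cell_cell => //;
  [exact: vertex_origin|rewrite card_std].
  by apply: reached_cube (state0 h T0) _ _.
- split=> //; have [K [vx cK /eqP K4 QE]] := mosaic_cell_at (leqnn _) mQ xQ.1.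
  have tK : tetra K by rewrite /tetra cK K4.
  have Qx := xQ.1; rewrite QE in xQ; have [_ Kx] := (largest_top x vx tK).1 xQ.
  have [n [S st]] := Qr _ Qx.
  have S0 : S \subset finset.set0.
    have Dl := descents_link hP cT0 st.
    rewrite (tetra_top hP vx tK Kx) in Dl.
    apply/fintype.subsetP => i iS; have /negP[] := tetra_max i tK.
    by apply/linkP => j jK; rewrite adj_sym;
      have /linkP := fintype.subsetP Dl _ jK; apply.
  have [K' [_ cK' _ ->]] := mosaic_cell_at (leqnn _) mQ' Q'x.
  by apply: reached_cube st cK' _;
    apply: fintype.subset_trans S0 (finset.sub0set _).
split=> //.
have [x x12] : exists x, (Q1 `&` Q2) x.
  have [z [J [vz cJ _ ->]]] := (mosaic_cellP hP _ (isT : 2 <= 4)).1 m12.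
  by exists z; apply: cell_refl.
have [K1 [vx c1 /eqP k1 E1]] := mosaic_cell_at (leqnn _) m1 x12.1.
have [K2 [_ c2 /eqP k2 E2]] := mosaic_cell_at (leqnn _) m2 x12.2.
have [K [_ cK _ E]] := mosaic_cell_at (leqnn _) mQ (sub _ x12).
have [n [S st]] := r1 _ x12.1.
rewrite E; apply: (reached_cube st cK).
have t1 : tetra K1 by rewrite /tetra c1.
have t2 : tetra K2 by rewrite /tetra c2.
have S1 : S \subset K1.
  by apply: (cell_reached hP cT0 st t1) => y xy; apply: r1; rewrite E1.
have S2 : S \subset K2.
  by apply: (cell_reached hP cT0 st t2) => y xy; apply: r2; rewrite E2.
have : S \subset (K1 :&: K2)%SET by rewrite finset.subsetI S1.
move/fintype.subset_trans; apply; apply/(cell_subP hP x) => y.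
by rewrite -(cellI hP) // -E1 -E2 -E; apply: sub.
Qed.

(** An incoming direction a leads to the level below, where the induction provides all hypercubes of
    P through that edge. They form the star of [a |: S], which [star_cross] extends to the star of
    S. *)
Lemma reached_pascal n x S (K : {set gen}) : state n x S -> tetra K ->
  S \subset K -> pascal (cell x K).
Proof.
elim/ltn_ind: n x S K => n IH x S K st tK SK.
have vx := state_vertex hP st; have /andP[cK /eqP K4] := tK.
case: n IH st => [IH st|n IH st].
  have [xE SE] : x = V0 /\ S = T0.
    have h0 k y T : state k y T -> k = 0 -> y = V0 /\ T = T0 by case.
    exact: h0 st (erefl _).
  rewrite SE in SK; rewrite xE; have -> : K = T0; last exact: pascal_first.
  by apply/esym/eqP; rewrite eqEcard SK K4 card_std.
have [a ax] := state_succ hP st.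
have aS : a \in link S := fintype.subsetP (descents_link hP cT0 st) _ ax.
have cS := state_clique cT0 st.
pose Kn (L : {set gen}) := pascal (cell x L).
have sa : star Kn (a |: S)%SET.
  move=> L tL; rewrite finset.subUset finset.sub1set => /andP[aL SL].
  have [_ [S' [[<-] st' SE _]]] := state_down hP st ax.
  have /andP[cL _] := tL.
  rewrite /Kn -(cell_eq hP vx cL (step_in_cell _ _ aL)).
  apply: (IH n (ltnSn n)) st' tL _; apply/fintype.subsetP => j jS.
  have [->//|ja] := eqVneq j a; apply: (fintype.subsetP SL).
  by rewrite SE !inE ja.
have S4 : #|S| < 4.
  have [] := card_link (cliqueU1 cS aS); by rewrite cliqueU1_card.
apply: (star_cross _ cS S4 aS sa) tK SK => [K1 K2 L t1 t2 tL p1 p2 K12 sub|].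
  have /andP[c1 _] := t1; have /andP[c2 _] := t2; have /andP[cL /eqP L4] := tL.
  apply: (pascal_convex p1 p2); rewrite ?(cellI hP) //.
  - apply: mosaic_cell_cell => //; apply: sub_clique c1; exact: subsetIl.
  - exact: mosaic_cell_cell.
  - by apply/(cell_subP hP).
move=> K1 t1 aK1 L tL K1L; have /andP[c1 _] := t1; have /andP[cL /eqP L4] := tL.
(* The top of the hypercube of K1 is reached from x without the incoming direction a, so it is also
   a vertex of the hypercube of L. *)
have [t [xt Kt]] := top_ex hP vx c1.
have xt1 : cell x K1 t by apply: cellS xt; apply: subsetDl.
have xtL : cell x L t.
  apply: cellS xt; apply: fintype.subset_trans K1L; apply: finset.setDS.
  by rewrite finset.sub1set.
apply: (@pascal_next _ _ _ (cell x K1) t).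
- exact: sa.
- exact/largest_top.
- exact: mosaic_cell_cell.
- by [].
Qed.

Lemma pascal_at n x S Q : state n x S ->
  (pascal Q /\ Q x) <-> exists K :
    {set gen}, [/\ tetra K, S \subset K & Q = cell x K].
Proof.
move=> st; split=> [[/pascal_reached[mQ Qr] Qx]|[K [tK SK ->]]]; last first.
  by split; [apply: reached_pascal st tK SK|apply: cell_refl].
have [K [vx cK /eqP K4 QE]] := mosaic_cell_at (leqnn _) mQ Qx.
have tK : tetra K by rewrite /tetra cK.
exists K; split=> //; apply: (cell_reached hP cT0 st tK) => y xy.
by apply: Qr; rewrite QE.
Qed.

Lemma pascal_edgeP x y : pascal_edge V0 Q0 x y <->
  exists n S i, [/\ state n x S, i \in S :|: link S & y = step x i].
Proof.
split=> [/asboolP[xy [Q pQ sub]]|[n [S [i [st iS ->]]]]].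
  have [_ Qr] := pascal_reached pQ.
  have [|n [S st]] := Qr x; first by apply: sub; left.
  have [vx [i yE]] := (mosaic_edgeP hP x y).1 xy.
  exists n, S, i; split=> //; apply/(reached_step hP cT0 _ st).
  by rewrite -yE; apply: Qr; apply: sub; right.
apply/asboolP; split.
  by apply/(mosaic_edgeP hP); split; [apply: state_vertex st|exists i].
have cS := state_clique cT0 st.
have ciS : clique (i |: S)%SET.
  move: iS; rewrite finset.in_setU => /orP[iS|]; last exact: cliqueU1.
  by rewrite (finset.setUidPr _) // finset.sub1set.
have [K tK iSK] := tetra_ex ciS.
move: iSK; rewrite finset.subUset finset.sub1set => /andP[iK SK].
exists (cell x K); first exact: reached_pascal st tK SK.
by move=> z [->|->]; [apply: cell_refl|apply: step_in_cell].
Qed.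

Lemma pascal_edge_state x n S : state n x S -> forall y,
  pascal_edge V0 Q0 x y <-> exists2 i, i \in S :|: link S & y = step x i.
Proof.
move=> st y; rewrite pascal_edgeP; split=> [[m [S' [i [st' iS ->]]]]|[i iS ->]].
  by have [_ ->] := state_uniq hP st st'; exists i.
by exists n, S, i.
Qed.

Lemma levelP n x : level V0 Q0 n x <-> exists S, state n x S.
Proof.
split=> [[p [pw ps] pn]|[S st]]; last first.
  have [p pw pn] := state_walk pascal_edge_state st.
  exists p => //; split=> // q qw; rewrite pn.
  exact: (walk_size hP pascal_edge_state st qw).
have /andP[pp /eqP px] := pw.
have [m [S [st mn]]] := path_state hP pascal_edge_state (state0 h T0) pp.
rewrite px in st; exists S.
have := (shortest_pathsP hP pascal_edge_state p st).1 (conj pw ps).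
by rewrite pn => /andP[_ /eqP ->].
Qed.

Lemma degree_state n x S : state n x S ->
  degree V0 Q0 x = #|S| + #|link S|.
Proof.
move=> st; have inj := @step_inj _ _ hP x.
rewrite /degree (@card_set_of _ _ _ (S :|: link S)%SET _ inj).
  rewrite -cardsUI addnC (_ : (_ :&: _)%SET = finset.set0) ?cards0 ?add0n //.
  apply/setP => i; rewrite finset.in_setI finset.in_set0.
  by case: (boolP (i \in link S)) => [/link_notin/negPf->|]; rewrite ?andbF.
exact: pascal_edge_state st.
Qed.

Lemma incoming_state n x S : state n x S -> incoming V0 Q0 x = #|descents x|.
Proof.
move=> st; have inj := @step_inj _ _ hP x; have vx := state_vertex hP st.
apply: (card_set_of inj) => y; split=> [[/pascal_edgeP[m [S' [i [st' iS'
  xE]]]]]|].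
  move=> [k [/levelP[S1 st1] /levelP[S2 st2]]].
  have vy := state_vertex hP st'; exists i; last by rewrite xE (stepK hP).
  rewrite xE (descents_step_id hP) //; apply/negP => iy.
  have [m' [S3 [mE st3 _ _]]] := state_down hP st' iy.
  rewrite -xE in st3; have [kE _] := state_uniq hP st2 st3.
  have [mk _] := state_uniq hP st' st1.
  by move: mk; rewrite mE -kE => /eqP; rewrite eqn_leq ltnNge leqnSn.
move=> [i ix ->]; have [m [S' [nE st' SE iS']]] := state_down hP st ix.
split.
  by apply/pascal_edgeP; exists m, S', i; rewrite (stepK hP).
by exists m; split; apply/levelP; [exists S'|exists S; rewrite -nE].
Qed.

(** The hypercubes of P containing a k-cell J at x are spanned by the tetrahedra over J and S; a
    single one remains only if J and S together fill it. Conversely, leaving out 4 - k elements of S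
    from such a tetrahedron K gives a k-cell whose only hypercube is that of K. *)
Lemma on_face_state n x S k : 0 < k < 4 -> state n x S ->
  on_face V0 Q0 k x <-> 4 - k <= #|S|.
Proof.
move=> /andP[k0 k4] st; have cS := state_clique cT0 st.
have vx := state_vertex hP st; have kle : k <= 4 := ltnW k4.
split=> [[c [mc cx [Q [[pQ sub] uQ]]]]|Sk].
  have [J [_ cJ Jk cE]] := mosaic_cell_at kle mc cx.
  have [K [tK SK QE]] := (pascal_at Q st).1 (conj pQ (sub _ cx)).
  have JK : J \subset K by apply/(cell_subP hP x); rewrite -cE -QE.
  rewrite leqNgt; apply/negP => Sk.
  have [||K' [tK' JSK' K'K]] := @tetra_other (J :|: S) K tK.
  - by rewrite finset.subUset JK.
  - apply: (@leq_ltn_trans (#|J| + #|S|)); first by rewrite -cardsUI leq_addr.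
    by rewrite Jk -ltn_subRL.
  move: JSK'; rewrite finset.subUset => /andP[JK' SK'].
  have E : Q = cell x K'.
    apply: uQ; split; first by apply: (reached_pascal st tK' SK').
    by rewrite cE; apply/(cell_subP hP).
  move/negP: K'K; apply; rewrite finset.eqEsubset.
  by apply/andP; split; apply/(cell_subP hP x); rewrite -QE -E.
have [K tK SK] := tetra_ex cS; have /andP[cK /eqP K4] := tK.
have [B BS Bk] : exists2 B : {set gen}, B \subset S & #|B| = 4 - k.
  exists (finset (mem (take (4 - k) (enum S)))).
    by apply/fintype.subsetP => i; rewrite finset.in_set => /mem_take;
      rewrite mem_enum.
  rewrite cardsE (card_uniqP _) ?take_uniq ?enum_uniq //.
  by rewrite size_takel // -cardE.
have BK := fintype.subset_trans BS SK.
have cJ : clique (K :\: B)%SET by apply: sub_clique cK; apply: subsetDl.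
have Jk : #|(K :\: B)%SET| = k.
  by rewrite cardsD (finset.setIidPr BK) K4 Bk subKn.
exists (cell x (K :\: B)%SET); split.
- exact: mosaic_cell_cell.
- exact: cell_refl.
exists (cell x K); split.
  split; first by apply: (reached_pascal st tK SK).
  by apply/(cell_subP hP); apply: subsetDl.
move=> Q' [pQ' sub].
have [|K' [tK' SK' QE']] := (pascal_at Q' st).1.
  by split=> //; apply: sub; apply: cell_refl.
have /andP[_ /eqP K4'] := tK'.
rewrite QE'; congr cell; apply/eqP; rewrite eqEcard K4 K4' leqnn andbT.
apply/fintype.subsetP => i iK; have [iB|iB] := boolP (i \in B).
  exact: (fintype.subsetP SK' _ (fintype.subsetP BS _ iB)).
apply: (step_cell hP (x := x)); rewrite -QE'; apply: sub.
by apply: step_in_cell; rewrite finset.in_setD iB.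
Qed.

End Pascal.

(** * Counting the vertices of a level *)

Lemma sum_keys (T : Type) (K : eqType) (key : T -> K) (F : K -> nat)
    (s : seq T) (ks : seq K) : uniq ks -> all (fun x => key x \in ks) s ->
  \sum_(x <- s) F (key x) = \sum_(k <- ks) count (fun x => key x == k) s * F k.
Proof.
move=> uk; elim: s => [_|x s IH /= /andP[xk /IH sE]].
  by rewrite big_nil big1.
rewrite big_cons sE (bigD1_seq (key x)) //= [in RHS](bigD1_seq (key x)) //=
  eqxx.
rewrite mulnDl mul1n addnA; congr (_ + _).
by apply: eq_bigr => k; rewrite eq_sym => /negPf->.
Qed.

Definition degree_table (p : nat) : nat := p + nth 0 [:: 120; 12; 5; 2; 0] p.

(* A kind is the size of the set S of a state together with the number of
   incoming edges of its vertex. *)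
Definition transitions (k k' : nat * nat) : nat :=
  ((k'.1.+1 == k.1) && (k'.2 == k.2.+1)) * k.1 +
  (k'.1 == k.1) * link_table k.1 k.2 k'.2.-1.

(** The pairs (p, q) with q >= 1 and p + q <= 4, listed in the order of the types A, ..., K, 1. *)
Definition kinds : seq (nat * nat) :=
  [:: (2, 2); (2, 1); (1, 3); (1, 2); (1, 1); (0, 4); (0, 3); (0, 2); (0, 1);
    (3, 1)].

Definition kind (t : vertex_type) : nat * nat :=
  match t with
  | tOne => (3, 1) | tA => (2, 2) | tB => (2, 1) | tC => (1, 3) | tD => (1, 2)
  | tE => (1, 1) | tF => (0, 4) | tG => (0, 3) | tH => (0, 2) | tK => (0, 1)
  end.

Section Counting.

Variable R : realType.
Local Notation row := 'rV[R]_5.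
Variable h : row -> row.
Hypothesis hP : mosaic_symmetry h.

Local Notation V0 := (origin h).
Local Notation vertex := (vertex h).
Local Notation step := (step h).
Local Notation descents := (descents h).
Local Notation cell := (cell h).
Local Notation T0 := (std 0 4).
Local Notation Q0 := (cell V0 T0).
Local Notation state := (state h T0).

Let cT0 : clique T0.
Proof. by have /andP[] := std4_tetra. Qed.

Lemma state_kind n x S : state n x S ->
  [/\ clique (S :|: descents x)%SET, [disjoint S & descents x]%bool &
      #|S| + #|descents x| <= 4].
Proof.
move=> st; have Dl := descents_link hP cT0 st.
have cU : clique (S :|: descents x)%SET.
  have cS := cliqueP _ (state_clique cT0 st).
  have cD := cliqueP _ (clique_descents hP (state_vertex hP st)).
  apply/cliqueP => i j; rewrite !finset.in_setU => /orP[iS|iD] /orP[jS|jD] ij.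
  - exact: cS.
  - by rewrite adj_sym; have /linkP := fintype.subsetP Dl _ jD; apply.
  - by have /linkP := fintype.subsetP Dl _ iD; apply.
  - exact: cD.
have dis : [disjoint S & descents x]%bool.
  rewrite disjoint_sym disjoint_subset;
    apply/fintype.subsetP => i /(fintype.subsetP Dl).
  exact: link_notin.
by split=> //; have [] := clique_orbit cU dis.
Qed.

Lemma degree_card n x S : state n x S -> degree V0 Q0 x = degree_table #|S|.
Proof.
by move=> st; rewrite (degree_state hP st) (card_link (state_clique cT0 st)).2.
Qed.

(** S and the incoming directions form a clique of at most 4 elements, so three elements in S leave
    at most one incoming edge at each vertex on the way. *)
Lemma value_ray n x S : state n x S -> 2 < #|S| -> value V0 x = 1.
Proof.
elim=> [_|{n x S}n z S q st IH qz qS S3]; first exact: value_origin.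
have vz := state_vertex hP st.
have le := value_step hP vz qz.
have S3' : 2 < #|S| by apply: leq_trans S3 (subset_leq_card (subsetDl _ _)).
rewrite -(IH S3'); apply/esym/eqP; rewrite le.
have qd : q \in descents (step z q) by rewrite (descents_step_id hP).
have [_ _ card4] := state_kind (stateS st qz qS).
rewrite eq_sym eqEcard finset.sub1set qd cards1 /=.
by have := leq_trans (leq_add S3 (leqnn _)) card4.
Qed.

Lemma state_kinds n x S : state n.+1 x S -> (#|S|, #|descents x|) \in kinds.
Proof.
move=> st; have [_ _] := state_kind st.
have /card_gt0P : exists i, i \in descents x by apply: (state_succ hP st).
by move: #|S| #|descents x| => [|[|[|[|[|p]]]]] [|[|[|[|[|q]]]]].
Qed.

Definition sigma (x : row) : {set gen} :=
  xget finset.set0 [set S | exists n, state n x S].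

Lemma sigma_state n x S : state n x S -> sigma x = S.
Proof.
move=> st; have [m st'] : [set S | exists n, state n x S] (sigma x).
  by apply: (@xgetPex _ _ [set S | exists n, state n x S]); exists S, n.
by have [_ ->] := state_uniq hP st' st.
Qed.

Definition upward (x : row) : {set gen} :=
  ((sigma x :|: link (sigma x)) :\: descents x)%SET.

Fixpoint level_seq (n : nat) : seq row :=
  if n is m.+1 then undup [seq step x i | x <- level_seq m,
    i <- enum (upward x)]
  else [:: V0].

Lemma level_seq_uniq n : uniq (level_seq n).
Proof. by case: n => // n; apply: undup_uniq. Qed.

Lemma level_seqP n x : x \in level_seq n <-> exists S, state n x S.
Proof.
elim: n x => [|n IH] x /=.
  rewrite inE; split=> [/eqP->|[S st]]; first by exists T0; apply: state0.
  have h0 k y T : state k y T -> k = 0 -> y = V0 by case.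
  by apply/eqP; apply: h0 st (erefl _).
rewrite mem_undup; split=> [/allpairsPdep[y [i [/IH[S st] iy ->]]]|[S st]].
  move: iy; rewrite mem_enum /upward (sigma_state st) finset.in_setD =>
    /andP[iy iS].
  by exists (S :\ i)%SET; apply: stateS.
have [i ix] := state_succ hP st.
have [_ [S' [[<-] st' _ iS']]] := state_down hP st ix.
apply/allpairsPdep; exists (step x i), i; split.
- by apply/IH; exists S'.
- rewrite mem_enum /upward (sigma_state st') finset.in_setD iS' andbT.
  by rewrite (descents_step_id hP) ?negbK //; apply: state_vertex st.
by rewrite (stepK hP) //; apply: state_vertex st.
Qed.

Lemma level_seqE n x : level V0 Q0 n x <-> x \in level_seq n.
Proof. by rewrite (levelP hP) level_seqP. Qed.

Definition kind_of (x : row) : nat * nat := (#|sigma x|, #|descents x|).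

Definition kind_count (k : nat * nat) (n : nat) : nat :=
  count (fun x => kind_of x == k) (level_seq n).

(** Directions of S are adjacent to all incoming ones, which therefore all survive; directions of
    [link S] leave S unchanged and are counted by [link_table]. These are the two summands of
    [transitions]. *)
Lemma upward_count n x S k : state n x S -> 0 < k.2 ->
  #|[set i in upward x | kind_of (step x i) == k]%SET| = transitions (kind_of
    x) k.
Proof.
move=> st k2; have vx := state_vertex hP st; have Dl := descents_link hP cT0 st.
have [cU dis _] := state_kind st; have SE := sigma_state st.
rewrite /transitions /= SE.
have inS i : i \in S -> i \in upward x /\ kind_of (step x i) = (#|S|.-1,
  #|descents x|.+1).
  move=> iS; have ix : i \notin descents x.
    by apply: contraL iS => /(fintype.subsetP Dl)/link_notin.
  have iU : i \in S :|: link S by rewrite finset.in_setU iS.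
  split; first by rewrite /upward SE finset.in_setD ix.
  rewrite /kind_of (sigma_state (stateS st ix iU)) (descents_step hP) //.
  have -> : [set j in descents x | adj i j]%SET = descents x.
    apply/setP => j; rewrite finset.in_set andb_idr // =>
      /(fintype.subsetP Dl)/linkP jS.
    by rewrite adj_sym; apply: jS.
  by rewrite cardsU1 ix [in RHS](cardsD1 i S) iS.
have inL i : i \in link S -> i \notin descents x -> i \in upward x /\
    kind_of (step x i) = (#|S|, #|[set j in descents x | adj i j]%SET|.+1).
  move=> iL ix; have iU : i \in S :|: link S by rewrite finset.in_setU iL orbT.
  split; first by rewrite /upward SE finset.in_setD ix.
  rewrite /kind_of (sigma_state (stateS st ix iU)) (descents_step hP) //.
  have -> : (S :\ i)%SET = S.
    by apply/finset.setDidPl; rewrite disjoint_sym disjoints1 link_notin.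
  by rewrite cardsU1 finset.in_set (negPf ix).
set U := [set i in upward x | _]%SET.
rewrite -(cardsID S U); congr (_ + _).
  have [/andP[/eqP kp /eqP kq]|nk] := boolP ((k.1.+1 == #|S|) && (k.2 ==
    #|descents x|.+1)).
    rewrite mul1n; apply: eq_card => i; rewrite finset.in_setI finset.in_set.
    apply: andb_idl => /inS[-> ->]; rewrite -kp -kq /=.
    by case: (k).
  rewrite mul0n; apply/eqP; rewrite cards_eq0; apply/eqP/setP => i.
  rewrite finset.in_set0 finset.in_setI finset.in_set; apply/negbTE.
  apply/negP => /andP[/andP[_ /eqP kE] iS]; have [_ kE'] := inS i iS.
  move: nk; rewrite -kE kE' /= prednK ?eqxx //.
  by apply/card_gt0P; exists i.
have upL i : i \in U -> i \notin S -> i \in link S /\ i \notin descents x.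
  rewrite finset.in_set /upward SE finset.in_setD finset.in_setU.
  by move=> /andP[/andP[-> /orP[->|->]]].
have [/eqP kp|nk] := boolP (k.1 == #|S|).
  rewrite mul1n -(link_count _ cU dis); apply: eq_card => i.
  rewrite finset.in_setD finset.in_set;
    apply/andP/andP => [[iS iU]|[iL /andP[ix ik]]].
    have [iL ix] := upL i iU iS; rewrite iL ix; split=> //.
    move: iU; rewrite finset.in_set => /andP[_].
    by have [_ ->] := inL i iL ix; move/eqP => <- /=.
  split; first exact: link_notin.
  rewrite finset.in_set; have [-> ->] := inL i iL ix;
    rewrite (eqP ik) prednK //.
  by rewrite -kp -surjective_pairing eqxx.
rewrite mul0n; apply/eqP; rewrite cards_eq0; apply/eqP/setP => i.
rewrite finset.in_setD finset.in_set0; apply/negbTE/negP => /andP[iS iU].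
have [iL ix] := upL i iU iS; move: iU nk;
  rewrite finset.in_set => /andP[_ /eqP <-].
by have [_ ->] := inL i iL ix; rewrite eqxx.
Qed.

(** The edges between levels n and n + 1 are counted at both ends, matching [(x, i)] below with
    [(step x i, i)] above; a vertex of kind k is the upper end of [k.2] of them. *)
Lemma edge_count n k : 0 < k.2 ->
  k.2 * kind_count k n.+1 = \sum_(x <- level_seq n) transitions (kind_of x) k.
Proof.
move=> k2; pose P x := kind_of x == k.
transitivity (\sum_(y <- level_seq n.+1) \sum_(i <- enum (descents y)) P y).
  rewrite /kind_count -sum1_count big_distrr /= [LHS]big_mkcond.
  apply: eq_bigr => y _; rewrite /P; case: eqP => [<-|_]; last by rewrite big1.
  by rewrite /= muln1 big_const_seq count_predT -cardE iter_addn_0 mul1n.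
transitivity (\sum_(x <- level_seq n) \sum_(i <- enum (upward x)) P (step x
  i)); last first.
  apply: eq_big_seq => x /level_seqP[S st]; rewrite -(upward_count st k2).
  rewrite -sum1_card big_enum [RHS]big_mkcond [LHS]big_mkcond;
    apply: eq_bigr => i _.
  by rewrite finset.in_set -/(P _); case: (i \in _); case: (P _).
have big_pairs (F : row -> gen -> nat) (A : row -> {set gen}) (s : seq row) :
    \sum_(x <- s) \sum_(i <- enum (A x)) F x i =
    \sum_(p <- [seq (x, i) | x <- s, i <- enum (A x)]) F p.1 p.2.
  by rewrite big_allpairs_dep.
rewrite (big_pairs (fun y _ => P y)) (big_pairs (fun x i => P (step x i))).
have pair_uniq (A : row -> {set gen}) m :
    uniq [seq (x, i) | x <- level_seq m, i <- enum (A x)].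
  apply: allpairs_uniq_dep => [|x _|[x i] [y j] _ _ /= [-> ->]] //.
    exact: level_seq_uniq.
  exact: enum_uniq.
rewrite -(big_map (fun p => (step p.1 p.2, p.2)) predT (fun p => P p.1 : nat)).
have vl m x i : (x, i) \in [seq (x, i) | x <- level_seq m,
  i <- enum (upward x)] ->
    vertex x.
  move=> /allpairsPdep[y [j [yl _ [-> _]]]].
  by have [S /(state_vertex hP)] := (level_seqP _ _).1 yl.
apply: perm_big; apply: uniq_perm; first exact: pair_uniq.
  rewrite map_inj_in_uniq ?pair_uniq // => -[x i] [y j] /vl vx /vl vy /= [e ij].
  by rewrite ij in e *; rewrite -(stepK hP j vx) e (stepK hP).
move=> [y i]; apply/allpairsPdep/mapP => [[z [j [zl jz [-> ->]]]]|].
  have [S st] := (level_seqP _ _).1 zl.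
  rewrite mem_enum in jz; have vz := state_vertex hP st.
  have [_ [S' [[<-] st' _ iS']]] := state_down hP st jz.
  exists (step z j, j); last by rewrite /= (stepK hP).
  apply/allpairsPdep; exists (step z j), j; split=> //;
    first by apply/level_seqP; exists S'.
  rewrite mem_enum /upward (sigma_state st') finset.in_setD iS' andbT.
  by rewrite (descents_step_id hP) // negbK.
move=> [_ /allpairsPdep[x [j [xl jx ->]]] /= [-> ->]].
have [S st] := (level_seqP _ _).1 xl.
move: jx; rewrite mem_enum /upward (sigma_state st) finset.in_setD =>
  /andP[jx jS].
exists (step x j), j; split=> //.
  by apply/(level_seqP n.+1); exists (S :\ j)%SET; apply: stateS.
by rewrite mem_enum (descents_step_id hP) //; apply: state_vertex st.
Qed.

(** It starts at level 1 because V0 has kind (4, 0), which is not in [kinds]; [kind_initial] treats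
    the step from level 0. *)
Lemma kind_recurrence n k : 0 < k.2 ->
  k.2 * kind_count k n.+2 =
  \sum_(k' <- kinds) kind_count k' n.+1 * transitions k' k.
Proof.
move=> k2; rewrite edge_count //.
apply: (@sum_keys _ _ kind_of (transitions^~ k)) => //.
apply/allP => x /level_seqP[S st].
by rewrite /kind_of (sigma_state st) (state_kinds st).
Qed.

Lemma kind_initial k : 0 < k.2 -> k.2 * kind_count k 1 = transitions (4, 0) k.
Proof.
move=> k2; rewrite edge_count // big_seq1 /kind_of.
by rewrite (sigma_state (state0 h T0)) (descents_origin hP) cards0 card_std.
Qed.

Lemma has_typeP n x S t : state n.+1 x S ->
  has_type V0 Q0 t x <-> kind_of x = kind t.
Proof.
move=> st; have := state_kinds st; rewrite /kind_of (sigma_state st) => kx.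
have inc := incoming_state hP st; have deg := degree_card st.
have f1 := on_face_state hP (isT : 0 < 1 < 4) st.
have f2 := on_face_state hP (isT : 0 < 2 < 4) st.
have f3 := on_face_state hP (isT : 0 < 3 < 4) st.
have xV0 : (x == V0) = false.
  apply/eqP => e; rewrite e in st.
  by have [] := state_origin hP st.
have val := value_ray st.
have p3 : #|S| < 4.
  by move: kx; rewrite !inE => /or4P[||| /or4P[||| /or4P[]]] /eqP[-> _].
have ray : ray_vertex V0 Q0 x <-> #|S| = 3.
  rewrite /ray_vertex deg xV0; split=> [[_ _]|p]; last first.
    by split; [apply/f1; rewrite p|apply: val; rewrite p|rewrite p].
  by move: #|S| p3 => [|[|[|[|]]]].
have face2 : face2_vertex V0 Q0 x <-> #|S| = 2.
  rewrite /face2_vertex deg; split=> [[_ _]|p]; last first.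
    by split; [apply/f2; rewrite p|move/f1; rewrite p|rewrite p].
  by move: #|S| p3 => [|[|[|[|]]]].
have face3 : face3_vertex V0 Q0 x <-> #|S| = 1.
  rewrite /face3_vertex deg; split=> [[_ _]|p]; last first.
    by split; [apply/f3; rewrite p|move/f2; rewrite p|rewrite p].
  by move: #|S| p3 => [|[|[|[|]]]].
have inner : interior_vertex V0 Q0 x <-> #|S| = 0.
  rewrite /interior_vertex deg; split=> [[_]|p]; last first.
    by split; [move/f3; rewrite p|rewrite p].
  by move: #|S| p3 => [|[|[|[|]]]].
case: t; rewrite /= ?inc ?ray ?face2 ?face3 ?inner;
  try by split=> [[-> ->]|[-> ->]].
split=> [p|[]//]; move: kx; rewrite p.
by case: #|descents x| => [|[|[|[|[|]]]]].
Qed.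

Lemma vertex_count_kind t n : vertex_count V0 Q0 t n.+1 = kind_count (kind t)
  n.+1.
Proof.
rewrite /kind_count -size_filter; apply: card_seq.
  by rewrite filter_uniq ?level_seq_uniq.
move=> x; rewrite mem_filter; split=> [[/level_seqE xl xt]|/andP[/eqP k xl]];
  have [S st] := (level_seqP _ _).1 xl.
  by rewrite xl andbT; apply/eqP/(has_typeP _ st).
by split; [apply/level_seqE|apply/(has_typeP _ st)].
Qed.

Lemma finite_level n : finite_set (level V0 Q0 n).
Proof.
have -> : level V0 Q0 n = [set` level_seq n].
  by apply/seteqP; split=> x /=; move/level_seqE.
exact: finite_seq.
Qed.

End Counting.

(** * Coefficients and initial values *)

Local Open Scope ring_scope.

Lemma frame_ex (R : realType) (V0 : 'rV[R]_5) (Q0 : set 'rV[R]_5) :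
  mosaic_cell 4 Q0 -> Q0 V0 ->
  exists h, [/\ mosaic_symmetry h, V0 = origin h &
                Q0 = cell h (origin h) (std 0 4)].
Proof.
move=> mQ Q0V0; have [g gP _] := mQ.
have [K [[w V0E] cK K4 Q0E]] := mosaic_cell_at gP (leqnn _) mQ Q0V0.
have [||_ [u uP [KE _]]] := @clique_orbit K finset.set0;
  rewrite ?finset.setU0 //.
  by rewrite -setI_eq0 finset.setI0.
rewrite K4 in KE; pose h := g \o (act w \o simple_act (R:=R) u).
have hP : mosaic_symmetry h.
  apply: symmetry_comp gP (symmetry_comp (act_symmetry _ _) _).
  exact: simple_act_symmetry.
have h0 : origin h = V0 by rewrite /origin /h /= simple_act_corner // V0E.
exists h; split=> //; rewrite Q0E KE V0E -(base_cell_image gP w uP (leqnn _)).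
rewrite -[std 0 4 in RHS]imset_id.
by apply: (@base_cell_image _ _ hP [::] [::]).
Qed.

(** Columns follow [kinds]. For a vertex of type F, for instance, 4, 6 and 12 directions are
    adjacent to exactly three, two and one vertices of its incoming tetrahedron and 94 others to
    none; with the 4 incoming ones they make 120. *)
Definition weights (t : vertex_type) : seq nat :=
  match t with
  | tA => [:: 2; 2; 0; 0; 0; 0; 0; 0; 0; 3]
  | tB => [:: 1; 2; 0; 0; 0; 0; 0; 0; 0; 0]
  | tC => [:: 2; 0; 3; 2; 0; 0; 0; 0; 0; 0]
  | tD => [:: 0; 2; 3; 4; 5; 0; 0; 0; 0; 0]
  | tE => [:: 0; 0; 3; 4; 6; 0; 0; 0; 0; 0]
  | tF => [:: 0; 0; 1; 0; 0; 4; 2; 0; 0; 0]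
  | tG => [:: 0; 0; 0; 1; 0; 6; 6; 5; 0; 0]
  | tH => [:: 0; 0; 0; 0; 1; 12; 12; 12; 12; 0]
  | tK => [:: 0; 0; 0; 0; 0; 94; 97; 101; 107; 0]
  | tOne => [:: 0; 0; 0; 0; 0; 0; 0; 0; 0; 1]
  end%N.

Lemma weightsE t : [seq transitions k (kind t) | k <- kinds] = weights t.
Proof. by case: t; vm_compute. Qed.

Lemma kind_step (R : realType) (h : 'rV[R]_5 -> 'rV[R]_5) t n :
  mosaic_symmetry h ->
  (kind t).2%:R * (kind_count h (kind t) n.+2)%:R =
  \sum_(p <- zip kinds (weights t)) p.2%:R * (kind_count h p.1 n.+1)%:R :> rat.
Proof.
move=> hP; rewrite -natrM (kind_recurrence hP); last by case: t.
rewrite -weightsE natr_sum -{2}[kinds]map_id zip_map big_map.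
by apply: eq_bigr => k _; rewrite natrM mulrC.
Qed.

Theorem theorem1 (R : realType) (V0 : 'rV[R]_5) (Q0 : set 'rV[R]_5)
    (V0_vertex : mosaic_cell 0 [set V0])
    (Q0_hypercube : mosaic_cell 4 Q0)
    (V0_Q0 : Q0 V0) :
  let a n : rat := (vertex_count V0 Q0 tA n)%:R in
  let b n : rat := (vertex_count V0 Q0 tB n)%:R in
  let c n : rat := (vertex_count V0 Q0 tC n)%:R in
  let d n : rat := (vertex_count V0 Q0 tD n)%:R in
  let e n : rat := (vertex_count V0 Q0 tE n)%:R in
  let f n : rat := (vertex_count V0 Q0 tF n)%:R in
  let g n : rat := (vertex_count V0 Q0 tG n)%:R in
  let h n : rat := (vertex_count V0 Q0 tH n)%:R in
  let k n : rat := (vertex_count V0 Q0 tK n)%:R in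
  let v n : rat := (vertex_count V0 Q0 tOne n)%:R in
  (forall n : nat, finite_set (level V0 Q0 n)) /\
  (forall n : nat, (1 <= n)%N ->
     a n.+1 = 1 / 2 * (2 * a n + 2 * b n + 3 * v n) /\
     b n.+1 = a n + 2 * b n /\
     c n.+1 = 1 / 3 * (2 * a n + 3 * c n + 2 * d n) /\
     d n.+1 = 1 / 2 * (2 * b n + 3 * c n + 4 * d n + 5 * e n) /\
     e n.+1 = 3 * c n + 4 * d n + 6 * e n /\
     f n.+1 = 1 / 4 * (c n + 4 * f n + 2 * g n) /\
     g n.+1 = 1 / 3 * (d n + 6 * f n + 6 * g n + 5 * h n) /\
     h n.+1 = 1 / 2 * (e n + 12 * f n + 12 * g n + 12 * h n + 12 * k n) /\
     k n.+1 = 94 * f n + 97 * g n + 101 * h n + 107 * k n /\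
     v n.+1 = v n) /\
  v 1%N = 4 /\ a 1%N = 0 /\ b 1%N = 0 /\ c 1%N = 0 /\ d 1%N = 0 /\
  e 1%N = 0 /\ f 1%N = 0 /\ g 1%N = 0 /\ h 1%N = 0 /\ k 1%N = 0.
Proof.
have [s [sP -> ->]] := frame_ex Q0_hypercube V0_Q0.
move=> a b c d e f g h k v; split=> [n|]; first exact: finite_level.
have countE t n : (vertex_count (origin s) (cell s (origin s) (std 0 4)) t
  n.+1)%:R
    = (kind_count s (kind t) n.+1)%:R :> rat by rewrite vertex_count_kind.
split=> [[//|n] _|].
  rewrite /a /b /c /d /e /f /g /h /k /v !countE /=.
  have := kind_step tA n sP; have := kind_step tB n sP.
  have := kind_step tC n sP; have := kind_step tD n sP.
  have := kind_step tE n sP; have := kind_step tF n sP.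
  have := kind_step tG n sP; have := kind_step tH n sP.
  have := kind_step tK n sP; have := kind_step tOne n sP.
  rewrite !big_cons !big_nil /=; lra.
have init t : (kind t).2%:R * (kind_count s (kind t) 1)%:R =
    (if t is tOne then 4 else 0) :> rat.
  rewrite -natrM (kind_initial sP); last by case: t.
  (* From V0 the only steps are the four directions of the first hypercube, each leading to kind (3,
     1). *)
  have -> : transitions (4, 0)%N (kind t) = (if t is tOne then 4 else 0)%N.
    by case: t; vm_compute.
  by case: t.
rewrite /a /b /c /d /e /f /g /h /k /v !countE.
have := init tA; have := init tB; have := init tC; have := init tD.
have := init tE; have := init tF; have := init tG; have := init tH.
have := init tK; have := init tOne; rewrite /=.
by do ![split]; lra.
Qed.
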